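(* Let $M$ be a regular matroid with ground set $E$, and fix an acyclic circuit signature $\sigma$ and an acyclic cocircuit signature $\sigma^*$ of $M$. Define $\varphi_{\sigma,\sigma^*}(\overrightarrow{O})=g_{\sigma,\sigma^*}^{-1}(\overrightarrow{O^{cp}})\cup(\biguplus_{i\in I}C_i)\setminus(\biguplus_{j\in J}C_j^* )$, where $\overrightarrow{O}$ is obtained by reversing pairwise disjoint signed circuits $\{\overrightarrow{C_i}\}_{i\in I}$ and signed cocircuits $\{\overrightarrow{C_j^*}\}_{j\in J}$ in a $(\sigma,\sigma^* )$-compatible orientation $\overrightarrow{O^{cp}}$. Then: (1) $\varphi_{\sigma,\sigma^*}$ is a bijection from the set of (discrete) orientations of $M$ to the set of subsets of $E$; (2) it restricts to a bijection from the $\sigma$-compatible orientations to the independent sets of $M$, given by $\overrightarrow{O}\mapsto g_{\sigma,\sigma^*}^{-1}(\overrightarrow{O^{cp}})\setminus(\biguplus_{j\in J}C_j^* )$; (3) it restricts to a bijection from the $\sigma^*$-compatible orientations to the spanning sets of $M$, given by $\overrightarrow{O}\mapsto g_{\sigma,\sigma^*}^{-1}(\overrightarrow{O^{cp}})\cup(\biguplus_{i\in I}C_i)$.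
   Context: A matroid is regular if it is represented over $\mathbb{R}$ by a totally unimodular matrix (every square submatrix has determinant $0,\pm1$); fix such a matrix $A$ of size $r\times n$ with rank $r$, columns indexed by $E$. For each circuit $C$ there are exactly two $\{0,\pm1\}$-vectors in $\ker(A)$ with support $C$, the signed circuits $\pm\overrightarrow{C}$; for each cocircuit $C^*$ exactly two $\{0,\pm1\}$-vectors in $\operatorname{im}(A^T)$ with support $C^*$, the signed cocircuits. An orientation of $M$ is a vector $\overrightarrow{O}\in\{0,1\}^E$; a signed circuit/cocircuit $v$ is ''in'' $\overrightarrow{O}$ if $O_e=1$ whenever $v_e=1$ and $O_e=0$ whenever $v_e=-1$; reversing it gives $\overrightarrow{O}-v$. A circuit signature $\sigma$ chooses one signed circuit $\sigma(C)$ for each circuit $C$; it is acyclic if $\sum_C a_C\sigma(C)=0$ with $a_C\ge0$ forces all $a_C=0$; an orientation is $\sigma$-compatible if every signed circuit in it lies in $\sigma$. Acyclic cocircuit signatures and $\sigma^*$-compatibility are analogous; $(\sigma,\sigma^* )$-compatible means both. For a basis $B$: $C(B,e)$ ($e\notin B$) is the fundamental circuit in $B\cup\{e\}$, $C^*(B,e)$ ($e\in B$) the fundamental cocircuit in $(E\setminus B)\cup\{e\}$. $g_{\sigma,\sigma^*}(B)$ is the orientation agreeing on each $e\notin B$ with $\sigma(C(B,e))$ and on each $e\in B$ with $\sigma^*(C^*(B,e))$; it is a bijection from bases onto $(\sigma,\sigma^* )$-compatible orientations. Every orientation is obtained from a unique $(\sigma,\sigma^* )$-compatible orientation $\overrightarrow{O^{cp}}$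 in its circuit–cocircuit reversal class by reversing pairwise disjoint signed circuits and cocircuits as in the claim (the unions of their supports being determined by $\overrightarrow{O}$). *)

(* Defs.v *)
From HB Require Import structures.
From mathcomp Require Import classical_sets functions reals.
From mathcomp Require Import all_boot all_order all_algebra.

Set Implicit Arguments.
Unset Strict Implicit.
Unset Printing Implicit Defensive.

Import Order.TTheory GRing.Theory Num.Theory.
Local Open Scope ring_scope.

Record matroid (T : finType) := Matroid {
  indep : {set T} -> bool;
  indep_set0 : indep set0;
  indep_sub : forall I J : {set T}, I \subset J -> indep J -> indep I;
  indep_exchange : forall I J : {set T}, indep I -> indep J ->
    (#|I| < #|J|)%N -> exists2 e, e \in J :\: I & indep (e |: I)
}.

Definition is_basis (T : finType) (M : matroid T) (B : {set T}) : bool :=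
  maxset (indep M) B.

Definition is_circuit (T : finType) (M : matroid T) (C : {set T}) : bool :=
  minset (fun D => ~~ indep M D) C.

Definition spanning (T : finType) (M : matroid T) (S : {set T}) : bool :=
  [exists B, is_basis M B && (B \subset S)].

(* The bases of the dual matroid are the complements of the bases of M, so
   these are its independent sets. *)
Definition coindep (T : finType) (M : matroid T) (D : {set T}) : bool :=
  [exists B, is_basis M B && (D \subset ~: B)].

Definition is_cocircuit (T : finType) (M : matroid T) (C : {set T}) : bool :=
  minset (fun D => ~~ coindep M D) C.

(* For a basis B there is exactly one such circuit when e \notin B, and
   exactly one such cocircuit when e \in B; set0 is a junk value. *)
Definition fund_circuit (T : finType) (M : matroid T) (B : {set T}) (e : T) :
    {set T} :=
  odflt set0 [pick C | is_circuit M C & C \subset e |: B].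

Definition fund_cocircuit (T : finType) (M : matroid T) (B : {set T}) (e : T) :
    {set T} :=
  odflt set0 [pick C | is_cocircuit M C & C \subset e |: ~: B].

Definition totally_unimodular (R : realType) (r n : nat) (A : 'M[R]_(r, n)) :
    Prop :=
  forall (k : nat) (f : 'I_k -> 'I_r) (g : 'I_k -> 'I_n),
    injective f -> injective g -> \det (mxsub f g A) \in [:: 0; 1; -1].

Definition represents (R : realType) (r n : nat) (A : 'M[R]_(r, n))
    (M : matroid 'I_n) : Prop :=
  forall I : {set 'I_n},
    indep M I = (\rank (colsub (fun k : 'I_#|I| => enum_val k) A) == #|I|).

Definition sign_vector (R : realType) (n : nat) (v : 'cV[R]_n) : bool :=
  [forall e, v e 0 \in [:: 0; 1; -1]].

Definition supp (R : realType) (n : nat) (v : 'cV[R]_n) : {set 'I_n} :=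
  [set e | v e 0 != 0]%SET.

Definition signed_circuit (R : realType) (r n : nat) (A : 'M[R]_(r, n))
    (M : matroid 'I_n) (C : {set 'I_n}) (v : 'cV[R]_n) : Prop :=
  [/\ is_circuit M C, sign_vector v, A *m v = 0 & supp v = C].

Definition signed_cocircuit (R : realType) (r n : nat) (A : 'M[R]_(r, n))
    (M : matroid 'I_n) (C : {set 'I_n}) (v : 'cV[R]_n) : Prop :=
  [/\ is_cocircuit M C, sign_vector v,
      exists u : 'cV[R]_r, v = A^T *m u & supp v = C].

(* Signatures are total functions on subsets of the ground set; only their
   values at circuits (resp. cocircuits) matter. *)
Definition circuit_signature (R : realType) (r n : nat) (A : 'M[R]_(r, n))
    (M : matroid 'I_n) (sigma : {set 'I_n} -> 'cV[R]_n) : Prop :=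
  forall C, is_circuit M C -> signed_circuit A M C (sigma C).

Definition cocircuit_signature (R : realType) (r n : nat) (A : 'M[R]_(r, n))
    (M : matroid 'I_n) (sigma' : {set 'I_n} -> 'cV[R]_n) : Prop :=
  forall C, is_cocircuit M C -> signed_cocircuit A M C (sigma' C).

(* P is meant to be is_circuit M or is_cocircuit M. *)
Definition acyclic (R : realType) (n : nat) (P : pred {set 'I_n})
    (s : {set 'I_n} -> 'cV[R]_n) : Prop :=
  forall a : {set 'I_n} -> R, (forall C, P C -> 0 <= a C) ->
    \sum_(C | P C) a C *: s C = 0 -> forall C, P C -> a C = 0.

Definition orientation (n : nat) := {ffun 'I_n -> bool}.

Definition orientation_vec (R : realType) (n : nat) (O : orientation n) :
    'cV[R]_n :=
  \col_e (O e)%:R.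

Definition in_orientation (R : realType) (n : nat) (v : 'cV[R]_n)
    (O : orientation n) : Prop :=
  forall e, (v e 0 = 1 -> O e = true) /\ (v e 0 = -1 -> O e = false).

Definition circuit_compatible (R : realType) (r n : nat) (A : 'M[R]_(r, n))
    (M : matroid 'I_n) (sigma : {set 'I_n} -> 'cV[R]_n) (O : orientation n) :
    Prop :=
  forall C v, signed_circuit A M C v -> in_orientation v O -> v = sigma C.

Definition cocircuit_compatible (R : realType) (r n : nat) (A : 'M[R]_(r, n))
    (M : matroid 'I_n) (sigma' : {set 'I_n} -> 'cV[R]_n) (O : orientation n) :
    Prop :=
  forall C v, signed_cocircuit A M C v -> in_orientation v O -> v = sigma' C.

(* The map g_{sigma, sigma^*} of Backman, Baker and Yuen, sigma^* being written
   sigma'. *)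
Definition bbyg (R : realType) (n : nat) (M : matroid 'I_n)
    (sigma sigma' : {set 'I_n} -> 'cV[R]_n) (B : {set 'I_n}) : orientation n :=
  [ffun e => if e \in B then sigma' (fund_cocircuit M B e) e 0 == 1
             else sigma (fund_circuit M B e) e 0 == 1].

(* O is obtained from Ocp by reversing the signed circuits in cs and the signed
   cocircuits in ds.  As the supports are pairwise disjoint, reversing one of
   them does not affect whether the others are in the orientation, so all of
   them can be required to be in Ocp and reversed simultaneously. *)
Definition reversal (R : realType) (r n : nat) (A : 'M[R]_(r, n))
    (M : matroid 'I_n) (Ocp : orientation n) (cs ds : seq 'cV[R]_n)
    (O : orientation n) : Prop :=
  [/\ forall v, v \in cs ->
        (exists C, signed_circuit A M C v) /\ in_orientation v Ocp,
      forall v, v \in ds ->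
        (exists C, signed_cocircuit A M C v) /\ in_orientation v Ocp,
      pairwise (fun u v => [disjoint supp u & supp v]) (cs ++ ds) &
      orientation_vec R O =
        orientation_vec R Ocp - \sum_(v <- cs) v - \sum_(v <- ds) v].

(* B is the preimage under bbyg of the compatible orientation Ocp, from which O
   is obtained by reversing cs and ds. *)
Definition decomposition (R : realType) (r n : nat) (A : 'M[R]_(r, n))
    (M : matroid 'I_n) (sigma sigma' : {set 'I_n} -> 'cV[R]_n)
    (O Ocp : orientation n) (B : {set 'I_n}) (cs ds : seq 'cV[R]_n) : Prop :=
  [/\ circuit_compatible A M sigma Ocp, cocircuit_compatible A M sigma' Ocp,
      reversal A M Ocp cs ds O, is_basis M B & bbyg M sigma sigma' B = Ocp].

Definition supp_union (R : realType) (n : nat) (vs : seq 'cV[R]_n) :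
    {set 'I_n} :=
  \bigcup_(v <- vs) supp v.

Definition phi_graph (R : realType) (r n : nat) (A : 'M[R]_(r, n))
    (M : matroid 'I_n) (sigma sigma' : {set 'I_n} -> 'cV[R]_n)
    (O : orientation n) (S : {set 'I_n}) : Prop :=
  exists Ocp B cs ds, decomposition A M sigma sigma' O Ocp B cs ds /\
    S = (B :|: supp_union cs) :\: supp_union ds.

(* The default value set0 is used only if no S satisfies phi_graph. *)
Definition phi (R : realType) (r n : nat) (A : 'M[R]_(r, n))
    (M : matroid 'I_n) (sigma sigma' : {set 'I_n} -> 'cV[R]_n)
    (O : orientation n) : {set 'I_n} :=
  xget set0%SET (phi_graph A M sigma sigma' O).

(* Main.v *)
(* The kernel and the row space of [A] are the fixed spaces of the orthogonal
   projections [P] and [1 - P], and everything is symmetric under exchanging [P]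
   with [1 - P], circuits with cocircuits, and bases with their complements. By
   Farkas' lemma the acyclic signatures are induced by linear functionals [p] and
   [q], positive on the signed circuits of [sigma], respectively on the signed
   cocircuits of [sigma'].

   Every orientation reaches a compatible one, namely a maximizer of [p + q] in
   its reversal class, and linear programming duality on the tangent cone of the
   cube at a compatible orientation gives its basis. The complementary solutions
   of that linear program certify the basis. For the injectivity of [phi], the
   certificates of two orientations with the same image, perturbed by the reversed
   circuits and cocircuits, have differences in the kernel and in the row space
   whose entrywise products are all nonpositive. These products sum to zero, hence
   vanish, and positivity of [p] and [q] then forces the differences to be zero.
   Bijectivity follows by counting. *)

Require Import Defs.
From HB Require Import structures.
From mathcomp Require Import boolp classical_sets functions reals.
From mathcomp Require Import all_boot all_order all_algebra.
From mathcomp Require Import ring lra zify.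

Set Implicit Arguments.
Unset Strict Implicit.
Unset Printing Implicit Defensive.

Import Order.TTheory GRing.Theory Num.Theory.
Local Open Scope ring_scope.

(** * Farkas' lemma *)

Section Farkas.
Context (R : realFieldType) (V : lmodType R) (I : eqType).

(* Bartl's induction: if dropping the functional [a i] breaks the implication
   at some [x0], then [a i x0 > 0], and the other functionals, corrected so as
   to vanish at [x0], satisfy the implication without [a i]. *)
Lemma farkas_seq (s : seq I) (a : I -> V -> R) (b : V -> R) :
    uniq s -> (forall i, scalar (a i)) -> scalar b ->
    (forall x, (forall i, i \in s -> a i x <= 0) -> b x <= 0) ->
  exists2 l : I -> R, forall i, 0 <= l i &
    forall x, b x = \sum_(i <- s) l i * a i x.
Proof.
elim: s a b => [|i s IHs] a b.
  move=> _ _ lin_b b_le0; exists (fun=> 0) => // x; rewrite big_nil.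
  have b_N y : b (- y) = - b y.
    have := lin_b 1 0 0; rewrite scale1r mul1r addr0 => b0.
    by have := lin_b (-1) y 0; rewrite scaleN1r addr0 => ->; lra.
  by apply/eqP; rewrite eq_le b_le0 //= -oppr_le0 -b_N b_le0.
move=> /= /andP[i_s uniq_s] lin_a lin_b b_le0.
case: (EM (forall x, (forall j, j \in s -> a j x <= 0) -> b x <= 0)) => [h|h].
  have [l l_ge0 b_eq] := IHs a b uniq_s lin_a lin_b h.
  exists (fun j => if j == i then 0 else l j) => [j|x]; first by case: ifP.
  rewrite big_cons eqxx mul0r add0r b_eq; apply: eq_big_seq => j j_s.
  by case: eqP => // ji; rewrite -ji j_s in i_s.
have [x0 a_x0 b_x0] : exists2 x0, forall j, j \in s -> a j x0 <= 0 & 0 < b x0.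
  have /existsNP[x0 /not_implyP[a_x0 /negP b_x0]] := h.
  by exists x0; rewrite // ltNge.
have ai_x0 : 0 < a i x0.
  rewrite ltNge; apply/negP => ai_x0; move: b_x0; rewrite ltNge b_le0 // => j.
  by rewrite inE => /orP[/eqP->|/a_x0].
pose f (g : V -> R) x := g x - g x0 / a i x0 * a i x.
have lin_f g : scalar g -> scalar (f g).
  by move=> lin_g c x y; rewrite /f lin_g lin_a; ring.
have [l l_ge0 fb_eq] : exists2 l : I -> R, forall j, 0 <= l j &
    forall x, f b x = \sum_(j <- s) l j * f (a j) x.
  apply: IHs => // [j||x fa_le0]; [exact: lin_f | exact: lin_f |].
  pose y := (- (a i x / a i x0)) *: x0 + x.
  have f_y g : scalar g -> g y = f g x.
    by move=> lin_g; rewrite /y lin_g /f; field; apply: lt0r_neq0.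
  rewrite -f_y //; apply: b_le0 => k; rewrite inE => /orP[/eqP->|j_s].
    by rewrite f_y // /f divff ?lt0r_neq0// mul1r subrr.
  by rewrite f_y // fa_le0.
pose li := b x0 / a i x0 - \sum_(j <- s) l j * (a j x0 / a i x0).
exists (fun j => if j == i then li else l j) => [j|x].
  case: ifP => // _; rewrite subr_ge0; apply: (@le_trans _ _ 0).
    rewrite big_seq; apply: sumr_le0 => k k_s; apply: mulr_ge0_le0 => //.
    by rewrite pmulr_lle0 ?invr_gt0 // a_x0.
  by rewrite divr_ge0 ?ltW.
rewrite big_cons eqxx.
rewrite (eq_big_seq (fun j => l j * f (a j) x + l j * (a j x0 / a i x0) * a i x)).
  rewrite big_split /= -fb_eq -mulr_suml /li /f.
  by ring.
move=> j j_s; case: eqP => [ji|_]; first by rewrite -ji j_s in i_s.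
by rewrite /f; ring.
Qed.

End Farkas.

Lemma farkas (R : realFieldType) (V : lmodType R) (I : finType)
    (a : I -> V -> R) (b : V -> R) :
    (forall i, scalar (a i)) -> scalar b ->
    (forall x, (forall i, a i x <= 0) -> b x <= 0) ->
  exists2 l : I -> R, forall i, 0 <= l i & forall x, b x = \sum_i l i * a i x.
Proof.
move=> lin_a lin_b b_le0.
have [|l l_ge0 b_eq] := farkas_seq (index_enum_uniq I) lin_a lin_b.
  by move=> x a_le0; apply: b_le0 => i; apply: a_le0; rewrite mem_index_enum.
by exists l.
Qed.

(** * The standard inner product on column vectors *)

Section Dot.
Context (R : realFieldType) (n : nat).
Implicit Types u v w : 'cV[R]_n.

Definition dot u v : R := \sum_e u e 0 * v e 0.

Lemma dotC u v : dot u v = dot v u.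
Proof. by apply: eq_bigr => e _; rewrite mulrC. Qed.

Lemma dotE u v : dot u v = (u^T *m v) 0 0.
Proof. by rewrite mxE; apply: eq_bigr => e _; rewrite mxE. Qed.

Lemma dotDl u v w : dot (u + v) w = dot u w + dot v w.
Proof. by rewrite !dotE linearD mulmxDl mxE. Qed.

Lemma dotZl a u v : dot (a *: u) v = a * dot u v.
Proof. by rewrite !dotE linearZ -scalemxAl mxE. Qed.

Lemma dotNl u v : dot (- u) v = - dot u v.
Proof. by rewrite -scaleN1r dotZl mulN1r. Qed.

Lemma dotBl u v w : dot (u - v) w = dot u w - dot v w.
Proof. by rewrite dotDl dotNl. Qed.

Lemma dotDr u v w : dot u (v + w) = dot u v + dot u w.
Proof. by rewrite !(dotC u) dotDl. Qed.

Lemma dotZr a u v : dot u (a *: v) = a * dot u v.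
Proof. by rewrite !(dotC u) dotZl. Qed.

Lemma dotNr u v : dot u (- v) = - dot u v.
Proof. by rewrite !(dotC u) dotNl. Qed.

Lemma dotBr u v w : dot u (v - w) = dot u v - dot u w.
Proof. by rewrite !(dotC u) dotBl. Qed.

Lemma dot_suml (I : Type) (s : seq I) (P : pred I) (F : I -> 'cV[R]_n) u :
  dot (\sum_(i <- s | P i) F i) u = \sum_(i <- s | P i) dot (F i) u.
Proof.
apply: (big_morph (fun v => dot v u)) => [v w|]; first exact: dotDl.
by rewrite -(scale0r 0) dotZl mul0r.
Qed.

Lemma dot_eq0 u : dot u u = 0 -> u = 0.
Proof.
move=> /eqP; rewrite psumr_eq0 => [/allP u0|e _]; last by rewrite -expr2 sqr_ge0.
apply/matrixP => e j; rewrite ord1 mxE; apply/eqP.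
by have := u0 e (mem_index_enum e); rewrite mulf_eq0 orbb.
Qed.

Lemma dot_inj u v : (forall w, dot u w = dot v w) -> u = v.
Proof.
move=> uv; apply/eqP; rewrite -subr_eq0; apply/eqP/dot_eq0.
by rewrite dotBl uv subrr.
Qed.

Lemma dot_trmx (P : 'M[R]_n) u v : dot (P *m u) v = dot u (P^T *m v).
Proof. by rewrite !dotE trmx_mul mulmxA. Qed.

(** A sum of nonnegative terms that is at most zero has only zero terms. Below it is applied mostly
    to orthogonal vectors whose entrywise products have a common sign. *)
Lemma dot_ge0_eq0 u v : (forall e, 0 <= u e 0 * v e 0) -> dot u v <= 0 ->
  forall e, u e 0 * v e 0 = 0.
Proof.
move=> uv_ge0 uv_le0 e; apply/eqP.
have /eqP : dot u v = 0.
  by apply/eqP; rewrite eq_le uv_le0 sumr_ge0.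
by rewrite psumr_eq0 // => /allP/(_ e (mem_index_enum e)).
Qed.

End Dot.

(** * Circuits of a subspace *)

Section Projection.
Context (R : realType) (n : nat).
Implicit Types (P : 'M[R]_n) (u v w c : 'cV[R]_n) (C D I B : {set 'I_n}).

(** Orthogonal projections. A subspace is handled as the fixed space of such a matrix, so that its
    orthogonal complement is the fixed space of [1%:M - P]. *)
Definition proj P := P^T = P /\ P *m P = P.

Lemma proj_compl P : proj P -> proj (1%:M - P).
Proof.
move=> [PT PP]; split; first by rewrite linearB /= trmx1 PT.
by rewrite mulmxBr mulmx1 mulmxBl mul1mx PP subrr subr0.
Qed.

Lemma compl_complK P : 1%:M - (1%:M - P) = P.
Proof. by rewrite subKr. Qed.

Lemma fix_compl P w : (1%:M - P) *m w = w <-> P *m w = 0.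
Proof.
rewrite mulmxBl mul1mx; split=> [/eqP|->]; last by rewrite subr0.
by rewrite subr_eq addrC -subr_eq subrr => /eqP.
Qed.

Lemma fix_orth P v w : proj P -> P *m v = v -> (1%:M - P) *m w = w ->
  dot v w = 0.
Proof.
move=> [PT _] Pv /fix_compl Pw.
by rewrite -Pv dot_trmx PT Pw dotC -(scale0r 0) dotZl mul0r.
Qed.

Lemma orth_fix P w : proj P -> (forall v, P *m v = v -> dot v w = 0) ->
  (1%:M - P) *m w = w.
Proof.
move=> [PT PP] orth_w; apply/fix_compl/dot_inj => x.
rewrite dot_trmx PT dotC orth_w ?mulmxA ?PP //.
by rewrite -(scale0r 0) dotZl mul0r.
Qed.

Lemma fixD P u v : P *m u = u -> P *m v = v -> P *m (u + v) = u + v.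
Proof. by move=> Pu Pv; rewrite mulmxDr Pu Pv. Qed.

Lemma fixZ P a u : P *m u = u -> P *m (a *: u) = a *: u.
Proof. by move=> Pu; rewrite -scalemxAr Pu. Qed.

Lemma fixN P u : P *m u = u -> P *m (- u) = - u.
Proof. by move=> Pu; rewrite mulmxN Pu. Qed.

Lemma fixB P u v : P *m u = u -> P *m v = v -> P *m (u - v) = u - v.
Proof. by move=> Pu Pv; rewrite fixD ?fixN. Qed.

Lemma fix_sum P (vs : seq 'cV[R]_n) : (forall v, v \in vs -> P *m v = v) ->
  P *m (\sum_(v <- vs) v) = \sum_(v <- vs) v.
Proof. by move=> Pvs; rewrite mulmx_sumr; apply: eq_big_seq. Qed.

Lemma in_supp v e : (e \in supp v) = (v e 0 != 0).
Proof. by rewrite inE. Qed.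

Lemma suppP v D : reflect (forall e, e \notin D -> v e 0 = 0) (supp v \subset D).
Proof.
apply: (iffP subsetP) => vD e; last by rewrite inE; apply: contraR => /vD ->.
by move=> eD; apply/eqP; apply: contraR eD => ve; rewrite vD ?inE.
Qed.

Lemma supp_eq0 v : (supp v == set0) = (v == 0).
Proof.
apply/eqP/eqP => [v0|->]; last by apply/setP => e; rewrite !inE mxE eqxx.
apply/matrixP => e j; rewrite ord1 mxE; apply/eqP.
by have := in_set0 e; rewrite -v0 inE => /negbFE.
Qed.

Lemma suppN v : supp (- v) = supp v.
Proof. by apply/setP => e; rewrite !inE mxE oppr_eq0. Qed.

Lemma sign_vectorN v : sign_vector v -> sign_vector (- v).
Proof.
move=> /forallP sv; apply/forallP => e; rewrite mxE; move: (sv e).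
rewrite !inE => /or3P[] /eqP->; by rewrite ?oppr0 ?opprK ?eqxx ?orbT.
Qed.

Lemma sign_vectorP v e : sign_vector v ->
  [\/ v e 0 = 0, v e 0 = 1 | v e 0 = -1].
Proof.
move=> /forallP/(_ e); rewrite !inE => /or3P[] /eqP; by constructor.
Qed.

(** When the fixed space of [P] is the kernel of a matrix, this is linear dependence of the columns
    indexed by [D]; for [1%:M - P] it is dependence in the dual matroid. *)
Definition ldep P D : bool :=
  `[< exists v, [/\ P *m v = v, v != 0 & supp v \subset D] >].

Definition lcirc P C : bool := minset (ldep P) C.

Definition lsigned P C v : Prop :=
  [/\ lcirc P C, sign_vector v, P *m v = v & supp v = C].

(** The second clause, independence of [~: B] in the dual, stands for spanning; in this form duality
    merely swaps the two clauses. *)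
Definition lbasis P B : Prop :=
  (forall v, P *m v = v -> supp v \subset B -> v = 0) /\
  (forall w, (1%:M - P) *m w = w -> supp w \subset ~: B -> w = 0).

Lemma lbasis_compl P B : lbasis P B -> lbasis (1%:M - P) (~: B).
Proof. by rewrite /lbasis compl_complK setCK => -[]. Qed.

Lemma ldepP P D : reflect
  (exists v, [/\ P *m v = v, v != 0 & supp v \subset D]) (ldep P D).
Proof. exact: asboolP. Qed.

(** A Fredholm alternative. If row [e] of [Q] is a combination of the rows indexed by [I], the
    coefficients give [v]; otherwise some vector is killed by the rows in [I] but not by row [e],
    and its image under [Q], rescaled, is [w]. *)
Lemma dichotomy P I e : proj P -> e \notin I ->
  (exists v, [/\ P *m v = v, v e 0 = 1 & supp v \subset e |: I]) \/
  (exists w, [/\ (1%:M - P) *m w = w, w e 0 = 1 & supp w \subset ~: I]).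
Proof.
move=> P_proj eI; have [QT QQ] := proj_compl P_proj; set Q := 1%:M - P in QT QQ *.
have QP (x : 'cV[R]_n) : Q *m x = 0 -> P *m x = x.
  by move=> Qx; have [_ /(_ Qx)] := fix_compl Q x; rewrite compl_complK.
clearbody Q.
pose G := \matrix_(i, j) (if i \in I then Q i j else 0).
have [/submxP[a rowQ]|] := boolP (row e Q <= G)%MS.
  left; pose v : 'cV[R]_n := \col_i ((i == e)%:R - (i \in I)%:R * a 0 i).
  exists v; split; last 2 first.
  - by rewrite mxE eqxx (negPf eI) mul0r subr0.
  - apply/suppP => i; rewrite in_setU1 negb_or => /andP[ie iI].
    by rewrite mxE (negPf ie) (negPf iI) mul0r subrr.
  apply/QP/matrixP => i j; rewrite ord1 !mxE.
  have QC k l : Q k l = Q l k by rewrite -{1}QT mxE.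
  under eq_bigr => k _ do rewrite mxE mulrBr.
  rewrite sumrB (bigD1 e) //= eqxx mulr1 big1 ?addr0 => [|k /negPf->]; last first.
    by rewrite mulr0.
  apply/eqP; rewrite subr_eq0 QC.
  have := congr1 (fun X : 'rV_n => X 0 i) rowQ; rewrite !mxE => ->.
  apply/eqP/eq_bigr => k _; rewrite !mxE (QC i); case: ifP => _.
    by rewrite mul1r mulrC.
  by rewrite mul0r !mulr0.
rewrite submxE => /eqP coker_n0; right.
have [j Qe_n0] : exists j, (Q *m cokermx G) e j != 0.
  apply/existsP; apply: contra_notT coker_n0; rewrite negb_exists => /forallP h.
  apply/matrixP => i j; rewrite ord1 -row_mul mxE [RHS]mxE.
  by apply/eqP; have := h j; rewrite negbK.
pose w := Q *m col j (cokermx G); pose x := (Q *m cokermx G) e j.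
have wE i : w i 0 = (Q *m cokermx G) i j.
  by rewrite !mxE; apply: eq_bigr => k _; rewrite mxE.
exists (x^-1 *: w); split.
- by rewrite fixZ // /w mulmxA QQ.
- by rewrite mxE wE mulVf.
apply/suppP => i; rewrite inE negbK => iI; rewrite mxE wE.
suff -> : (Q *m cokermx G) i j = (G *m cokermx G) i j.
  by rewrite mulmx_coker mxE mulr0.
by rewrite !mxE; apply: eq_bigr => k _; rewrite [G i k]mxE iI.
Qed.

(* Subtracting the multiple of [u] given by the least ratio [v e / u e] kills an
   entry of [v] and changes no sign. *)
Lemma conformal_elim u v : supp u \subset supp v ->
    (exists e, 0 < u e 0 * v e 0) ->
  exists2 a : R, 0 < a & (forall e, 0 <= (v - a *: u) e 0 * v e 0) /\
    supp (v - a *: u) \proper supp v.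
Proof.
move=> suv [e0 e0_gt0].
have [e e_gt0 e_min] := @arg_minP _ _ _ e0 (fun e => 0 < u e 0 * v e 0)
  (fun e => v e 0 / u e 0) e0_gt0.
have ue_n0 : u e 0 != 0 by apply: contraTneq e_gt0 => ->; rewrite mul0r ltxx.
have ve_n0 : v e 0 != 0 by apply: contraTneq e_gt0 => ->; rewrite mulr0 ltxx.
have vE x : (v - (v e 0 / u e 0) *: u) x 0 = v x 0 - v e 0 / u e 0 * u x 0.
  by rewrite !mxE.
exists (v e 0 / u e 0).
  have -> : v e 0 / u e 0 = u e 0 * v e 0 / u e 0 ^+ 2 by field.
  by rewrite divr_gt0 ?exprn_even_gt0.
split=> [x|].
  rewrite vE; have [x_gt0|x_le0] := ltP 0 (u x 0 * v x 0).
    have ux_n0 : u x 0 != 0 by apply: contraTneq x_gt0 => ->; rewrite mul0r ltxx.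
    have := e_min x x_gt0; rewrite -subr_ge0 -(pmulr_rge0 _ x_gt0) => h.
    apply: le_trans h _; rewrite le_eqVlt; apply/orP; left; apply/eqP.
    by field; apply/andP.
  have a_ge0 : 0 <= v e 0 / u e 0.
    have -> : v e 0 / u e 0 = u e 0 * v e 0 / u e 0 ^+ 2 by field.
    by rewrite divr_ge0 ?sqr_ge0 ?ltW.
  by have := sqr_ge0 (v x 0); have := mulr_ge0_le0 a_ge0 x_le0; nra.
apply/properP; split; last first.
  by exists e; rewrite ?inE // vE divfK // subrr eqxx.
apply/suppP => x; rewrite inE negbK => /eqP vx; rewrite vE vx.
have /suppP/(_ x) -> := suv; first by rewrite mulr0 subrr.
by rewrite inE vx eqxx.
Qed.

Lemma sgn_trans (x y z : R) : 0 <= x * y -> 0 <= y * z -> (y = 0 -> x = 0) ->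
  0 <= x * z.
Proof.
move=> xy yz y0; have [/y0->|y_n0] := eqVneq y 0; first by rewrite mul0r.
have y2 : 0 < y ^+ 2 by rewrite exprn_even_gt0.
by rewrite -(pmulr_rge0 _ y2); have := mulr_ge0 xy yz; nra.
Qed.

Definition signature P (s : {set 'I_n} -> 'cV[R]_n) :=
  forall C, lcirc P C -> lsigned P C (s C).

Lemma lsignedN P C v : lsigned P C v -> lsigned P C (- v).
Proof. by case=> ? ? ? ?; split; rewrite ?sign_vectorN ?fixN ?suppN. Qed.

Lemma lcirc_neq0 P C : lcirc P C -> C != set0.
Proof.
move=> /minsetp /ldepP[v [_ v_n0 vC]]; apply: contraNneq v_n0 => C0.
by rewrite -supp_eq0 -subset0 -C0.
Qed.

Lemma ldep_circ P D : ldep P D -> exists2 C, lcirc P C & C \subset D.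
Proof. by move=> /minset_exists[C ? ?]; exists C. Qed.

Lemma circ_indep P C v : lcirc P C -> P *m v = v -> supp v \proper C -> v = 0.
Proof.
move=> C_circ Pv vC; apply/eqP/negPn/negP => v_n0.
have C_dep : ldep P (supp v) by apply/ldepP; exists v.
have /minsetP[_ C_min] := C_circ.
by have := vC; rewrite properE (C_min _ C_dep (proper_sub vC)) subxx.
Qed.

Lemma lsigned_unique P C u v : lsigned P C u -> lsigned P C v ->
  u = v \/ u = - v.
Proof.
move=> [C_circ su Pu uC] [_ sv Pv vC].
have [e eC] := set0Pn _ (lcirc_neq0 C_circ).
have ve : v e 0 != 0 by rewrite -in_supp vC.
have ue : u e 0 != 0 by rewrite -in_supp uC.
pose a := u e 0 / v e 0.
have uv : u = a *: v.
  apply/eqP; rewrite -subr_eq0; apply/eqP.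
  apply: (circ_indep C_circ); first by rewrite fixB ?fixZ.
  apply/properP; split; last first.
    by exists e => //; rewrite in_supp !mxE divfK // subrr eqxx.
  apply/suppP => i iC; rewrite !mxE.
  have /eqP-> : u i 0 == 0 by rewrite -[_ == _]negbK -in_supp uC.
  have /eqP-> : v i 0 == 0 by rewrite -[_ == _]negbK -in_supp vC.
  by rewrite mulr0 subrr.
suff : a = 1 \/ a = -1.
  by case=> a1; [left|right]; rewrite uv a1 ?scale1r ?scaleN1r.
rewrite /a; move: ue ve.
case: (sign_vectorP e su) => ->; case: (sign_vectorP e sv) => ->;
  rewrite ?eqxx // => _ _; first [by left; field | by right; field].
Qed.

(** * Conformal decomposition into signed circuits *)

Section Signature.
Context (P : 'M[R]_n) (s : {set 'I_n} -> 'cV[R]_n) (s_sig : signature P s).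

(** Induction on the support. A circuit inside [supp v], signed so as to agree with [v] somewhere,
    is eliminated from [v]. If nothing is left, [v] is a positive multiple of it; otherwise the
    remainder has smaller support and is conformal to [v]. *)
Lemma conformal_circuit v : P *m v = v -> v != 0 ->
  exists C u, [/\ lsigned P C u, forall e, 0 <= u e 0 * v e 0 &
                  supp u \subset supp v].
Proof.
have [m] := ubnP #|supp v|; elim: m v => // m IHm v v_lt Pv v_n0.
have /ldep_circ[C C_circ Cv] : ldep P (supp v) by apply/ldepP; exists v.
have [u [u_signed [e ue]]] : exists u, lsigned P C u /\ exists e, 0 < u e 0 * v e 0.
  have [e eC] := set0Pn _ (lcirc_neq0 C_circ).
  have ve : v e 0 != 0 by rewrite -in_supp (subsetP Cv).
  have se : s C e 0 != 0 by have [_ _ _ sC] := s_sig C_circ; rewrite -in_supp sC.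
  have [h|] := ltP 0 (s C e 0 * v e 0).
    by exists (s C); split; [exact: s_sig|exists e].
  rewrite le_eqVlt mulf_eq0 (negPf se) (negPf ve) /= => h.
  exists (- s C); split; [exact/lsignedN/s_sig|exists e].
  by rewrite mxE mulNr oppr_gt0.
have [_ _ Pu uC] := u_signed.
have [|a a_gt0 [v'v sv']] := @conformal_elim u v _ (ex_intro _ e ue).
  by rewrite uC.
set v' := v - a *: u in v'v sv'.
have [v'0|v'_n0] := eqVneq v' 0.
  exists C, u; split; rewrite ?uC // => x.
  have /eqP := v'0; rewrite subr_eq0 => /eqP->; rewrite mxE mulrCA -expr2.
  by rewrite mulr_ge0 ?sqr_ge0 ?ltW.
have v'_lt : (#|supp v'| < m)%N.
  by apply: leq_trans (proper_card sv') _; rewrite -ltnS.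
have [|C' [u' [u'_signed u'v' su']]] := IHm _ v'_lt _ v'_n0.
  by rewrite /v' fixB ?fixZ.
exists C', u'; split=> // [x|]; last exact: subset_trans su' (proper_sub sv').
apply: sgn_trans (u'v' x) (v'v x) _ => v'x.
by have /suppP/(_ x) -> := su'; rewrite ?in_supp ?v'x ?eqxx.
Qed.

(** Peeling off circuits one at a time writes [b] as a positive combination of signed circuits
    conformal to it, and all of these belong to [s]. *)
Lemma conformal_pos p b : P *m b = b -> b != 0 ->
    (forall C, lcirc P C -> 0 < dot p (s C)) ->
    (forall C u, lsigned P C u -> supp u \subset supp b ->
       (forall e, 0 <= u e 0 * b e 0) -> u = s C) ->
  0 < dot p b.
Proof.
move=> + + p_pos; have [m] := ubnP #|supp b|.
elim: m b => // m IHm b b_lt Pb b_n0 b_compat.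
have [C [u [u_signed ub sub]]] := conformal_circuit Pb b_n0.
have [C_circ _ Pu uC] := u_signed.
have us : u = s C by apply: b_compat.
have [|a a_gt0 [b'b sb']] := @conformal_elim u b sub.
  have [e eC] := set0Pn _ (lcirc_neq0 C_circ).
  exists e; rewrite lt_neqAle ub andbT eq_sym mulf_neq0 // -in_supp ?uC //.
  by rewrite (subsetP sub) ?uC.
rewrite -(subrK (a *: u) b) dotDr dotZr; set b' := b - a *: u in b'b sb' *.
have au_gt0 : 0 < a * dot p u by rewrite us mulr_gt0 // p_pos.
have [->|b'_n0] := eqVneq b' 0; first by rewrite dotC -(scale0r 0) dotZl mul0r add0r.
rewrite addr_gt0 //; apply: IHm b'_n0 _.
- by apply: leq_trans (proper_card sb') _; rewrite -ltnS.
- by rewrite /b' fixB ?fixZ.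
move=> C' u' u'_signed su' u'b'; apply: b_compat => // [|e].
  exact: subset_trans su' (proper_sub sb').
apply: sgn_trans (u'b' e) (b'b e) _ => b'e.
by have /suppP/(_ e) -> := su'; rewrite ?in_supp ?b'e ?eqxx.
Qed.

(** A signed circuit conformal to a sign vector [c] equals [c] on its own support. Subtracting it
    restricts [c] to the complement of that support, so the circuits found successively are
    disjoint. *)
Lemma sign_vector_decomp c : P *m c = c -> sign_vector c ->
  exists cs : seq 'cV[R]_n,
  [/\ forall v, v \in cs -> (exists C, lsigned P C v) /\
        (forall e, v e 0 = 0 \/ v e 0 = c e 0),
      pairwise (fun u v => [disjoint supp u & supp v]) cs &
      c = \sum_(v <- cs) v].
Proof.
have [m] := ubnP #|supp c|; elim: m c => // m IHm c c_lt Pc sc.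
have [->|c_n0] := eqVneq c 0; first by exists [::]; rewrite big_nil.
have [C [u [u_signed uc suc]]] := conformal_circuit Pc c_n0.
have [C_circ su Pu uC] := u_signed.
have uE e : u e 0 = 0 \/ u e 0 = c e 0.
  have := uc e; have /suppP/(_ e) := suc; rewrite in_supp.
  case: (sign_vectorP e su) => ->; case: (sign_vectorP e sc) => ->;
    rewrite ?eqxx /=; [by left|by left|by left|move=> h _|move=> *|move=> *|move=> h _|move=> *|move=> *].
  - by left; apply: h.
  - by right.
  - lra.
  - by left; apply: h.
  - lra.
  - by right.
have cuE e : (c - u) e 0 = if e \in supp u then 0 else c e 0.
  rewrite !mxE in_supp; case: (uE e) => ->; first by rewrite eqxx subr0.
  by case: eqP => [->|_]; rewrite subrr.
have [|||cs [cs_c cs_disj cs_sum]] := IHm (c - u).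
- apply: leq_trans (_ : #|supp c| <= m)%N; last by rewrite -ltnS.
  apply/proper_card/properP; split.
    apply/suppP => e; rewrite in_supp negbK cuE => /eqP->; by case: ifP.
  have [e eC] := set0Pn _ (lcirc_neq0 C_circ).
  by exists e; rewrite ?(subsetP suc) ?uC // in_supp cuE uC eC eqxx.
- by rewrite fixB.
- apply/forallP => e; rewrite cuE; case: ifP => _; first by rewrite inE eqxx.
  by have /forallP := sc.
exists (u :: cs); split.
- move=> v; rewrite inE => /orP[/eqP->|v_cs]; first by split=> //; exists C.
  have [v_signed vcu] := cs_c _ v_cs; split=> // e.
  case: (vcu e) => [->|->]; first by left.
  by rewrite cuE; case: ifP; [left|right].
- rewrite /= cs_disj andbT; apply/allP => v v_cs.
  rewrite disjoints_subset; apply/subsetP => e eu; rewrite inE in_supp negbK.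
  by have [_ /(_ e)] := cs_c _ v_cs; rewrite cuE eu => -[->|->].
- by rewrite big_cons -cs_sum addrC subrK.
Qed.

End Signature.
End Projection.

(** * Compatible orientations *)

Section Orientation.
Context (R : realType) (n : nat).
Implicit Types (P : 'M[R]_n) (p q u v w c d : 'cV[R]_n) (C B : {set 'I_n}).
Implicit Types (s : {set 'I_n} -> 'cV[R]_n) (O : orientation n) (e : 'I_n).

(** Orientations become vertices of the cube with coordinates 1 and -1, so that agreeing with an
    orientation is nonnegativity of entrywise products. *)
Definition sg (o : bool) : R := if o then 1 else -1.
Definition osign O e : R := sg (O e).

Lemma osignP O e : osign O e = 1 \/ osign O e = -1.
Proof. by rewrite /osign /sg; case: (O e); [left|right]. Qed.

Lemma orientation_vecE O e :
  orientation_vec R O e 0 = (1 + osign O e) / 2.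
Proof. by rewrite mxE /osign /sg; case: (O e) => /=; lra. Qed.

Lemma in_orientationP v O : sign_vector v ->
  in_orientation v O <-> (forall e, v e 0 = 0 \/ v e 0 = osign O e).
Proof.
move=> sv; split=> vO e; last first.
  have := vO e; rewrite /osign /sg; case: (O e); split=> //; case: (vO e); lra.
have [v1 vN1] := vO e; rewrite /osign /sg.
case: (sign_vectorP e sv) => ve; [by left | right | right].
  by rewrite v1.
by rewrite vN1.
Qed.

Definition lcompat P s O : Prop :=
  forall C v, lsigned P C v -> in_orientation v O -> v = s C.

(** Taking [p] in the fixed space makes it orthogonal to the dual side, so that [p + q] evaluates as
    [p] on signed circuits and as [q] on signed cocircuits. *)
Definition positive P s p : Prop :=
  P *m p = p /\ forall C, lcirc P C -> 0 < dot p (s C).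

(** If no functional is nonnegative on all of [s] and positive at [s C0], Farkas' lemma writes
    [- s C0] as a nonnegative combination of the signature, against acyclicity. The functionals for
    all [C0] are summed, and the sum is projected to the fixed space. *)
Lemma acyclic_positive P s : proj P -> signature P s -> acyclic (lcirc P) s ->
  exists p, positive P s p.
Proof.
move=> [PT PP] s_sig s_acyclic.
suff [p p_pos] : exists p, forall C, lcirc P C -> 0 < dot p (s C).
  exists (P *m p); split=> [|C C_circ]; first by rewrite mulmxA PP.
  by rewrite dot_trmx PT; have [_ _ -> _] := s_sig _ C_circ; apply: p_pos.
have {}s_acyclic C0 : lcirc P C0 -> exists p,
    (forall C, lcirc P C -> 0 <= dot p (s C)) /\ 0 < dot p (s C0).
  move=> C0_circ; apply: contrapT => no_p.
  have [||x x_ge0|l l_ge0 sC0] := @farkas R 'cV[R]_n {set 'I_n}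
    (fun C x => if lcirc P C then dot (- s C) x else 0) (dot (s C0)).
  - move=> C k x y; case: ifP => _; last by rewrite mulr0 addr0.
    by rewrite dotDr dotZr.
  - by move=> k x y; rewrite dotDr dotZr.
  - rewrite leNgt; apply/negP => x_gt0; apply: no_p; exists x.
    split=> [C C_circ|]; last by rewrite dotC.
    by have := x_ge0 C; rewrite C_circ dotNl oppr_le0 dotC.
  suff /(_ C0 C0_circ) : forall C, lcirc P C -> l C + (C == C0)%:R = 0.
    by rewrite eqxx /= => /eqP; rewrite gt_eqF // ltr_pwDr.
  apply: s_acyclic => [C _|]; first by rewrite addr_ge0 ?ler0n.
  under eq_bigr do rewrite scalerDl.
  rewrite big_split /= [X in _ + X](bigD1 C0) //= eqxx scale1r.
  rewrite [X in _ + (_ + X)]big1 ?addr0 => [|C /andP[_ /negPf->]]; last by rewrite scale0r.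
  apply/dot_inj => x; rewrite dotDl sC0 dot_suml -(scale0r 0) dotZl mul0r.
  rewrite (big_mkcond (lcirc P)) -big_split big1 //= => C _.
  by case: ifP => _; rewrite ?dotNl ?dotZl ?mulr0 ?addr0 // mulrN subrr.
pose f C := if pselect (lcirc P C) is left C_circ then sval (cid (s_acyclic C C_circ)) else 0.
have f_ge0 C C' : lcirc P C' -> 0 <= dot (f C) (s C').
  move=> C'_circ; rewrite /f; case: pselect => [C_circ|_].
    by case: cid => p /= [/(_ _ C'_circ)].
  by rewrite -(scale0r 0) dotZl mul0r.
exists (\sum_C f C) => C C_circ; rewrite dot_suml (bigD1 C) //=.
apply: ltr_pwDl; last by apply: sumr_ge0 => C' _; apply: f_ge0.
by rewrite /f; case: pselect => // h; case: cid => p /= [].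
Qed.

(** A signed circuit conformal to [b] lies in [O], hence is chosen by [s], so [conformal_pos]
    applies. *)
Lemma compat_pos P s p O b : signature P s -> positive P s p ->
    lcompat P s O -> P *m b = b -> b != 0 ->
    (forall e, 0 <= b e 0 * osign O e) ->
  0 < dot p b.
Proof.
move=> s_sig [_ p_pos] O_compat Pb b_n0 bO.
apply: (conformal_pos s_sig Pb b_n0 p_pos) => C u u_signed ub u_b.
apply: O_compat => //; have [_ su _ _] := u_signed.
apply/in_orientationP => // e.
have := u_b e; have := bO e; have /suppP/(_ e) := ub; rewrite in_supp.
have [->|b_e] := eqVneq (b e 0) 0; first by move=> /(_ isT); left.
by move=> _; case: (osignP O e) => ->; case: (sign_vectorP e su) => ->;
  rewrite ?mulr1 ?mulrN1 ?mul1r ?mulN1r; move: b_e => /eqP b_e;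
  [left|right|move=> h1 h2; case: b_e; lra|left|move=> h1 h2; case: b_e; lra|right].
Qed.

Lemma compat_ge0 P s p O b : signature P s -> positive P s p ->
    lcompat P s O -> P *m b = b -> (forall e, 0 <= b e 0 * osign O e) ->
  0 <= dot p b.
Proof.
move=> s_sig p_pos O_compat Pb bO; have [->|b_n0] := eqVneq b 0.
  by rewrite dotC -(scale0r 0) dotZl mul0r.
exact: ltW (compat_pos s_sig p_pos O_compat Pb b_n0 bO).
Qed.

(* Linear programming duality on the tangent cone of the cube at the vertex
   [O]: [x] is primal feasible, [y] dual feasible, and the last clause is
   complementary slackness. *)
Lemma complementary_vertex P s s' p q O : proj P ->
    signature P s -> signature (1%:M - P) s' ->
    positive P s p -> positive (1%:M - P) s' q ->
    lcompat P s O -> lcompat (1%:M - P) s' O ->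
  exists x y, [/\ P *m (x + q) = x + q, (1%:M - P) *m (y + p) = y + p,
    forall e, osign O e * x e 0 <= 0, forall e, osign O e * y e 0 <= 0 &
    forall e, x e 0 * y e 0 = 0].
Proof.
move=> P_proj s_sig s'_sig p_pos q_pos O_s O_s'.
have [QT QQ] := proj_compl P_proj; have [PT PP] := P_proj.
have [Pp _] := p_pos; have [Qq _] := q_pos.
set Q := 1%:M - P in QT QQ Qq q_pos s'_sig O_s' *.
have PQ x : P *m (Q *m x) = 0 :> 'cV_n.
  by rewrite mulmxA /Q mulmxBr mulmx1 PP subrr mul0mx.
have PDQ x : P *m x + Q *m x = x :> 'cV_n.
  by rewrite -mulmxDl /Q addrC subrK mul1mx.
have orth v w : P *m v = v -> Q *m w = w -> dot v w = 0 by apply: fix_orth.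
pose V : lmodType R := ('cV[R]_n * R^o)%type.
(* The system is homogenized by the scale [z.2]: the candidates for [x] and [y] are [P *m z.1] and
   [Q *m z.1] divided by [z.2], minus [q] and [p]. The functional at [inr false] imposes the reverse
   of weak duality. *)
pose a (i : 'I_n + 'I_n + bool) (z : V) : R := match i with
  | inl (inl e) => osign O e * ((P *m z.1) e 0 - z.2 * q e 0)
  | inl (inr e) => osign O e * ((Q *m z.1) e 0 - z.2 * p e 0)
  | inr true => - z.2
  | inr false => - dot (p + q) z.1 end.
have lin_a i : scalar (a i).
  move=> k y z; rewrite /a.
  rewrite (_ : (k *: y + z).1 = k *: y.1 + z.1) //.
  rewrite (_ : (k *: y + z).2 = k * y.2 + z.2) //.
  case: i => [[e|e]|[]].
  - by rewrite mulmxDr -scalemxAr !mxE; ring.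
  - by rewrite mulmxDr -scalemxAr !mxE; ring.
  - by ring.
  - by rewrite dotDr dotZr; ring.
have [[[x t] [a_le0 t_gt0]]|no_z] :=
    EM (exists z : V, (forall i, a i z <= 0) /\ 0 < z.2).
  move: t_gt0 => /= t_gt0.
  have xE e : (t^-1 *: (P *m x) - q) e 0 = t^-1 * ((P *m x) e 0 - t * q e 0).
    by rewrite !mxE; field; apply: lt0r_neq0.
  have yE e : (t^-1 *: (Q *m x) - p) e 0 = t^-1 * ((Q *m x) e 0 - t * p e 0).
    by rewrite !mxE; field; apply: lt0r_neq0.
  have x_le0 e : osign O e * (t^-1 *: (P *m x) - q) e 0 <= 0.
    by rewrite xE mulrCA pmulr_rle0 ?invr_gt0 //; apply: (a_le0 (inl (inl e))).
  have y_le0 e : osign O e * (t^-1 *: (Q *m x) - p) e 0 <= 0.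
    by rewrite yE mulrCA pmulr_rle0 ?invr_gt0 //; apply: (a_le0 (inl (inr e))).
  exists (t^-1 *: (P *m x) - q), (t^-1 *: (Q *m x) - p); split=> //.
  - by rewrite subrK fixZ // mulmxA PP.
  - by rewrite subrK fixZ // mulmxA QQ.
  apply: dot_ge0_eq0 => [e|].
    by have := x_le0 e; have := y_le0 e; case: (osignP O e) => ->; nra.
  have /= := a_le0 (inr false); rewrite oppr_le0 dotDl => pq_ge0.
  have xp : dot (P *m x) p = dot p x by rewrite dot_trmx PT Pp dotC.
  have xq : dot q (Q *m x) = dot q x by rewrite dotC dot_trmx QT Qq dotC.
  have PxQx : dot (P *m x) (Q *m x) = 0 by rewrite orth ?mulmxA ?PP ?QQ.
  rewrite dotBl !dotBr !dotZl !dotZr PxQx xp xq (dotC q p) (orth p q) //.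
  rewrite (_ : _ - _ = - (t^-1 * (dot p x + dot q x))); last by ring.
  by rewrite oppr_le0; apply: mulr_ge0 => //; rewrite invr_ge0 ltW.
have [|z z_le0|l l_ge0 tE] := farkas lin_a (b := fun z : V => z.2).
- by move=> k y z.
- by rewrite leNgt; apply/negP => z_gt0; apply: no_z; exists z.
(* Infeasibility makes the scale a nonnegative combination of the constraints. The multipliers,
   signed by [O], form [f] and [g]. *)
pose f : 'cV[R]_n := \col_e (l (inl (inl e)) * osign O e).
pose g : 'cV[R]_n := \col_e (l (inl (inr e)) * osign O e).
pose del := l (inr false); have del_ge0 : 0 <= del by apply: l_ge0.
have fg_eq x t : t = dot f (P *m x) - t * dot f q + (dot g (Q *m x) - t * dot g p)
                   - l (inr true) * t - del * dot (p + q) x.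
  have fE : \sum_e l (inl (inl e)) * a (inl (inl e)) (x, t) =
      dot f (P *m x) - t * dot f q.
    rewrite /dot mulr_sumr -sumrB; apply: eq_bigr => e _ /=.
    by rewrite [f e 0]mxE; ring.
  have gE : \sum_e l (inl (inr e)) * a (inl (inr e)) (x, t) =
      dot g (Q *m x) - t * dot g p.
    rewrite /dot mulr_sumr -sumrB; apply: eq_bigr => e _ /=.
    by rewrite [g e 0]mxE; ring.
  rewrite -[LHS]/((x, t) : V).2 tE big_sumType big_sumType /= fE gE big_bool /=.
  by rewrite /del; ring.
have fgO e : 0 <= f e 0 * osign O e /\ 0 <= g e 0 * osign O e.
  by rewrite !mxE -!mulrA; case: (osignP O e) => ->; rewrite ?mulrNN !mulr1.
(* This compares the coefficients of [x] in [fg_eq]; the coefficient of [t] yields [fg_lt0]. *)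
have PQfg : P *m f + Q *m g = del *: (p + q).
  apply/dot_inj => x; rewrite dotDl dotZl !dot_trmx PT QT.
  by have := fg_eq x 0; rewrite !mul0r mulr0 !subr0; lra.
have Pf : P *m f = del *: p.
  have := congr1 (mulmx P) PQfg.
  by rewrite mulmxDr mulmxA PP PQ addr0 -scalemxAr mulmxDr Pp -Qq PQ addr0.
have Qg : Q *m g = del *: q.
  by apply: (addrI (P *m f)); rewrite PQfg Pf scalerDr.
have Pg_p : dot g p = dot (P *m g) p by rewrite dot_trmx PT Pp.
have Qf_q : dot f q = dot (Q *m f) q by rewrite dot_trmx QT Qq.
have fg_lt0 : dot f q + dot g p < 0.
  have := fg_eq 0 1; have := l_ge0 (inr true).
  rewrite !mulmx0 !mul1r -{1 2 3}(scale0r (0 : 'cV[R]_n)) !dotZr; lra.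
(* For [del = 0], [f] and [g] lie in the two fixed spaces and agree with [O], so compatibility makes
   [dot q f] and [dot p g] nonnegative. *)
have [del0|del_n0] := eqVneq del 0.
  have Qf : Q *m f = f by rewrite -[RHS]PDQ Pf del0 scale0r add0r.
  have Pg : P *m g = g by rewrite -[RHS]PDQ Qg del0 scale0r addr0.
  have := compat_ge0 s'_sig q_pos O_s' Qf (fun e => (fgO e).1).
  have := compat_ge0 s_sig p_pos O_s Pg (fun e => (fgO e).2).
  by rewrite (dotC q) (dotC p); move: fg_lt0; lra.
(* For [del > 0], [dot f g] is [del] times the negative number of [fg_lt0], although [f] and [g]
   both agree with [O]. *)
have fg_ge0 : 0 <= dot f g.
  apply: sumr_ge0 => e _; have := fgO e.
  by case: (osignP O e) => -> [*]; nra.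
move: fg_ge0; rewrite -(PDQ f) -(PDQ g) Pf Qg.
rewrite dotDl !dotDr (orth (del *: p) (del *: q)) ?fixZ // (dotC (Q *m f) (P *m g)).
rewrite (orth (P *m g)) ?mulmxA ?PP ?QQ // addr0 add0r dotZl dotZr.
rewrite (dotC p) -Pg_p -Qf_q -mulrDr pmulr_rge0 ?lt_def ?del_n0 //.
by move: fg_lt0; lra.
Qed.

End Orientation.

(** * Fundamental circuits and certificates of bases *)

Section Fundamental.
Context (R : realType) (n : nat).
Implicit Types (P : 'M[R]_n) (p q u v w c d : 'cV[R]_n) (C B : {set 'I_n}).
Implicit Types (s : {set 'I_n} -> 'cV[R]_n) (O : orientation n) (e : 'I_n).

Definition lfund P B e : {set 'I_n} :=
  odflt set0 [pick C | lcirc P C & C \subset e |: B].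

(** The second alternative of [dichotomy] would contradict the spanning clause of [lbasis], and a
    circuit avoiding [e] would lie in [B]. *)
Lemma lfundP P B e : proj P -> lbasis P B -> e \notin B ->
  [/\ lcirc P (lfund P B e), lfund P B e \subset e |: B & e \in lfund P B e].
Proof.
move=> P_proj [B_indep B_span] eB.
have [C C_circ CB] : exists2 C, lcirc P C & C \subset e |: B.
  apply: ldep_circ; have [[v [Pv ve vB]]|[w [Qw we wB]]] := dichotomy P_proj eB.
    apply/ldepP; exists v; split=> //.
    by apply: contra_eq_neq ve => ->; rewrite mxE eq_sym oner_eq0.
  by move/eqP: we; rewrite (B_span w Qw wB) mxE eq_sym oner_eq0.
rewrite /lfund; case: pickP => [D /andP[D_circ DB]|/(_ C)]; last first.
  by rewrite C_circ CB.
split=> //=; apply: contraT => eD.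
have /minsetp/ldepP[v [Pv v_n0 vD]] := D_circ.
case/eqP: v_n0; apply: B_indep => //; apply: subset_trans vD _.
apply/subsetP => i iD; have /subsetP/(_ i iD) := DB.
by rewrite in_setU1 => /orP[/eqP ie|//]; rewrite -ie iD in eD.
Qed.

(** Half of the condition that [bbyg] maps [B] to [O]; the other half is the same condition for
    [1%:M - P] and [~: B]. *)
Definition fund_agree P s B O : Prop :=
  forall e, e \notin B -> s (lfund P B e) e 0 = osign R O e.

(** On the fixed space of [P] the functional [p] coincides with [- v], which is supported exactly
    off [B] and has the signs of [O] there. *)
Definition certificate P p B O v : Prop :=
  [/\ (1%:M - P) *m (v + p) = v + p, forall e, e \in B -> v e 0 = 0 &
      forall e, e \notin B -> osign R O e * v e 0 < 0].

Lemma fund_dot P s B e v : proj P -> signature P s -> lbasis P B ->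
    e \notin B -> (forall i, i \in B -> v i 0 = 0) ->
  dot (s (lfund P B e)) v = s (lfund P B e) e 0 * v e 0.
Proof.
move=> P_proj s_sig B_basis eB vB.
have [C_circ CB eC] := lfundP P_proj B_basis eB.
have [_ _ _ sC] := s_sig _ C_circ.
rewrite /dot (bigD1 e) //= big1 ?addr0 // => i ie.
have [iB|iB] := boolP (i \in B); first by rewrite vB ?mulr0.
have /suppP/(_ i) -> : supp (s (lfund P B e)) \subset e |: B by rewrite sC.
  by rewrite mul0r.
by rewrite in_setU1 negb_or ie.
Qed.

(** Orthogonality to the fundamental circuits dictates the entries off [B], and these circuits span
    the fixed space of [P]. *)
Lemma certificate_exists P s p B O : proj P -> signature P s ->
    positive P s p -> lbasis P B -> fund_agree P s B O ->
  exists v, certificate P p B O v.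
Proof.
move=> P_proj s_sig [Pp p_pos] B_basis BO; have [B_indep _] := B_basis.
have fundP e eB := lfundP P_proj B_basis (eB : e \notin B).
pose f e := s (lfund P B e).
have Pf e : e \notin B -> P *m f e = f e.
  by move=> /fundP[C_circ _ _]; have [] := s_sig _ C_circ.
have fO e : e \notin B -> f e e 0 * osign R O e = 1.
  by move=> /BO->; case: (osignP R O e) => ->; rewrite ?mulrNN mulr1.
pose k : 'cV[R]_n := \col_e (if e \in B then 0 else - (osign R O e * dot p (f e))).
have kB e : e \in B -> k e 0 = 0 by move=> eB; rewrite mxE eB.
have kE e : e \notin B -> osign R O e * k e 0 = - dot p (f e).
  move=> eB; rewrite mxE (negPf eB); case: (osignP R O e) => ->; lra.
exists k; split=> // [|e eB]; last first.
  by rewrite kE // oppr_lt0 p_pos //; have [] := fundP e eB.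
apply: orth_fix => // v Pv.
have vE : v = \sum_(e | e \notin B) (v e 0 * osign R O e) *: f e.
  apply/eqP; rewrite -subr_eq0; apply/eqP/B_indep.
    rewrite fixB // mulmx_sumr; apply: eq_bigr => e eB.
    by rewrite fixZ // Pf.
  apply/suppP => e eB; rewrite !mxE summxE (bigD1 e) //= mxE.
  rewrite mulrAC -mulrA fO // mulr1 big1 ?addr0 ?subrr // => i /andP[iB ie].
  have [C_circ CB _] := fundP i iB; have [_ _ _ sC] := s_sig _ C_circ.
  have /suppP/(_ e) fe0 : supp (f i) \subset i |: B by rewrite sC.
  by rewrite mxE fe0 ?mulr0 // in_setU1 negb_or eq_sym ie.
rewrite vE dot_suml big1 // => e eB; rewrite dotZl dotDr.
rewrite (fund_dot P_proj) // -/(f e) (dotC _ p).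
have fk : f e e 0 * k e 0 = - dot p (f e).
  by rewrite -kE //; congr (_ * _); apply: BO.
by rewrite fk addNr mulr0.
Qed.

(** In the product of [v] with the fundamental circuit of [e] only the entry at [e] survives, and by
    orthogonality it is minus a positive number. So [v e 0] is nonzero, and the weak sign condition
    determines the sign of the circuit at [e]. *)
Lemma vertex_agree P s p B O v : proj P -> signature P s -> positive P s p ->
    lbasis P B -> (1%:M - P) *m (v + p) = v + p ->
    (forall e, e \in B -> v e 0 = 0) ->
    (forall e, osign R O e * v e 0 <= 0) ->
  fund_agree P s B O.
Proof.
move=> P_proj s_sig [Pp p_pos] B_basis Qvp vB vO e eB.
have [C_circ _ eC] := lfundP P_proj B_basis eB.
have [_ sv Pf sC] := s_sig _ C_circ.
have := fix_orth P_proj Pf Qvp; rewrite dotDr (fund_dot P_proj) //.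
have := p_pos _ C_circ; have := vO e; rewrite (dotC p).
have : s (lfund P B e) e 0 != 0 by rewrite -in_supp sC.
by case: (osignP R O e) => ->; case: (sign_vectorP e sv) => ->;
  rewrite ?eqxx // => _; lra.
Qed.

(** A signed circuit supported in [supp x] would be orthogonal to [y], hence to [p], against
    positivity; dually for [q] and signed cocircuits supported off [supp x]. *)
Lemma vertex_basis P s s' p q x y : proj P ->
    signature P s -> signature (1%:M - P) s' ->
    positive P s p -> positive (1%:M - P) s' q ->
    P *m (x + q) = x + q -> (1%:M - P) *m (y + p) = y + p ->
    (forall e, x e 0 * y e 0 = 0) ->
  lbasis P (supp x).
Proof.
move=> P_proj s_sig s'_sig [_ p_pos] [_ q_pos] Px Qy xy0.
split=> [v Pv vx|w Qw wx].
  apply/eqP/negPn/negP => v_n0.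
  have [C [u [u_signed _ uv]]] := conformal_circuit s_sig Pv v_n0.
  have [C_circ _ Pu _] := u_signed.
  have : dot u y = 0.
    rewrite /dot big1 // => e _; have := xy0 e.
    have /suppP/(_ e) := subset_trans uv vx; rewrite in_supp negbK.
    have [_ /(_ isT)->|xe _] := eqVneq (x e 0) 0; first by rewrite mul0r.
    by move/eqP; rewrite mulf_eq0 (negPf xe) /= => /eqP->; rewrite mulr0.
  have := fix_orth P_proj Pu Qy; rewrite dotDr => /[swap] ->; rewrite add0r.
  have := p_pos _ C_circ; rewrite (dotC p).
  by case: (lsigned_unique u_signed (s_sig _ C_circ)) => ->; rewrite ?dotNl; lra.
apply/eqP/negPn/negP => w_n0.
have [C [u [u_signed _ uw]]] := conformal_circuit s'_sig Qw w_n0.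
have [C_circ _ Qu _] := u_signed.
have : dot u x = 0.
  rewrite /dot big1 // => e _.
  have /suppP/(_ e) := subset_trans uw wx; rewrite in_setC in_supp !negbK.
  by have [-> _|_ /(_ isT)->] := eqVneq (x e 0) 0; rewrite ?mul0r ?mulr0.
have := fix_orth P_proj Px Qu; rewrite dotC dotDr => /[swap] ->; rewrite add0r.
have := q_pos _ C_circ; rewrite (dotC q).
case: (lsigned_unique u_signed (s'_sig _ C_circ)) => ->; rewrite ?dotNl; lra.
Qed.

(* Since [v + p] is orthogonal to [u], the value of [p] on [u] is minus that of
   [v], whose signs off [B] are opposite to those of [O]. *)
Lemma certificate_cone P p B O v u : proj P -> lbasis P B ->
    certificate P p B O v -> P *m u = u ->
    (forall e, e \notin B -> 0 <= osign R O e * u e 0) ->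
  0 <= dot p u /\ (dot p u <= 0 -> u = 0).
Proof.
move=> P_proj [B_indep _] [Qvp vB vO] Pu uO.
have puE : dot p u = dot u (- v).
  by have := fix_orth P_proj Pu Qvp; rewrite dotDr dotNr (dotC p); lra.
have uv_ge0 e : 0 <= u e 0 * (- v) e 0.
  rewrite mxE; have [eB|eB] := boolP (e \in B); first by rewrite vB // oppr0 mulr0.
  by have := vO e eB; have := uO e eB; case: (osignP R O e) => ->; nra.
rewrite puE; split=> [|uv_le0]; first exact: sumr_ge0.
apply: B_indep => //; apply/suppP => e eB.
have /eqP := dot_ge0_eq0 uv_ge0 uv_le0 e; rewrite mulf_eq0 mxE oppr_eq0.
case/orP => /eqP // ve; have := vO e eB; rewrite ve mulr0 ltxx //.
Qed.

End Fundamental.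

(** * Uniqueness and existence of decompositions *)

Section Edge.
Context (R : realType).
Implicit Types (N k l : R) (o b : bool) (t : option bool).

Local Notation sg := (sg R).

Lemma sg_mul o : sg o * sg o = 1.
Proof. by case: o; rewrite /sg ?mulrNN mulr1. Qed.

(* [Some true], [Some false] and [None] mark the elements of the reversed
   circuits, those of the reversed cocircuits, and the others. *)
Definition cpart t o : R := if t is Some true then sg o else 0.
Definition dpart t o : R := if t is Some false then sg o else 0.
Definition flip t o : bool := if t is None then o else ~~ o.
Definition chosen t b : bool := if t is Some x then x else b.

Definition cert_entry b o k l : Prop :=
  if b then k = 0 /\ sg o * l < 0 else sg o * k < 0 /\ l = 0.

(* [o] and [o'] are the directions of the element before and after the reversal.
   Exchanging [k] with [l] and complementing [b] gives the form of the entries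
   outside the image of [phi], by duality. *)
Definition edge_form N b o o' k l : Prop :=
  exists x z, [/\ k = sg o' * x, l = - (sg o' * z), 0 <= x, 0 < z <= N &
    if b then x = 0 /\ (o = o' -> z < N) else [/\ 0 < x, z = N & o = ~~ o']].

(** As certificate entries are below [N / 2] in absolute value, a perturbed entry keeps the sign of
    its [N] term, and an unperturbed one stays below [N]. *)
Lemma cert_entry_form N t b o k l :
    cert_entry b o k l -> 2 * `|k| < N -> 2 * `|l| < N ->
    let k' := N * dpart t o + k in let l' := N * cpart t o + l in
  if chosen t b then edge_form N b o (flip t o) k' l'
  else edge_form N (~~ b) o (flip t o) l' k'.
Proof.
move=> + k_lt l_lt /=; set k' := N * _ + k; set l' := N * _ + l.
have [/andP[k1 k2] /andP[l1 l2]] : (- (N / 2) < k < N / 2) /\ (- (N / 2) < l < N / 2).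
  by rewrite -!ltr_norml; split; lra.
have sgK o' m : m = sg o' * (sg o' * m) by rewrite mulrA sg_mul mul1r.
case: ifP => ch ent;
  [exists (sg (flip t o) * k'), (- (sg (flip t o) * l'))
  |exists (sg (flip t o) * l'), (- (sg (flip t o) * k'))];
  (split; [exact: sgK | by rewrite mulrN -sgK opprK | | apply/andP; split |]);
  rewrite {}/k' {}/l'; move: ch ent;
  case: t => [[]|]; case: b => // _; case: o;
  rewrite /cert_entry /flip /cpart /dpart /sg /= => -[? ?];
  first [lra | split=> //; lra | by split=> // _; lra | by split=> //; lra].
Qed.

Context (N k1 k2 l1 l2 : R) (o1 o2 o1' o2' b1 b2 : bool).
Hypotheses (form1 : edge_form N b1 o1 o1' k1 l1).
Hypotheses (form2 : edge_form N b2 o2 o2' k2 l2).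

(** Both points, with coordinates [k] and [l], lie on one descending staircase: the ray at height
    [N] to the left of the vertical axis, the segment of the axis between heights [N] and [-N], and
    the ray at height [-N] to the right. *)
Lemma edge_le0 : (k1 - k2) * (l1 - l2) <= 0.
Proof using All.
have [x1 [z1 [-> -> x1_ge0 /andP[z1_gt0 z1_le] h1]]] := form1.
have [x2 [z2 [-> -> x2_ge0 /andP[z2_gt0 z2_le] h2]]] := form2.
have {h1} h1 : x1 = 0 \/ z1 = N by case: b1 h1 => -[]; [left|right].
have {h2} h2 : x2 = 0 \/ z2 = N by case: b2 h2 => -[]; [left|right].
case: o1'; case: o2'; rewrite /sg; case: h1 => h1; case: h2 => h2; subst; nra.
Qed.

(** With [b1] the first point is on the vertical axis. If [k1] and [k2] differ, then [l1 = l2] and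
    the second point is on a ray, so the first is at an end of the segment; this happens only if
    [o1] was reversed, and the ray gives the sign. Without [b1], [l1] is extremal, namely [N] times
    the sign of [o1]. *)
Lemma edge_cone : (k1 - k2) * (l1 - l2) = 0 ->
  (b1 -> 0 <= sg o1 * (k1 - k2)) /\ (~~ b1 -> 0 <= sg o1 * (l1 - l2)).
Proof using All.
have [x1 [z1 [-> -> x1_ge0 /andP[z1_gt0 z1_le] h1]]] := form1.
have [x2 [z2 [-> -> x2_ge0 /andP[z2_gt0 z2_le] h2]]] := form2.
have {h2} h2 : x2 = 0 \/ z2 = N by case: b2 h2 => -[]; [left|right].
move/eqP; rewrite mulf_eq0 => uv; case: b1 h1; last first.
  case=> x1_gt0 z1N ->; split=> // _.
  by case/orP: uv => /eqP; case: o1'; case: o2'; rewrite /sg /=; lra.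
case=> x10 z1N; split=> // _.
have [oo|oo] := eqVneq o1 o1'.
  have {}z1N := z1N oo; rewrite oo.
  by case/orP: uv => /eqP; case: o1'; case: o2'; rewrite /sg /=;
    case: h2 => ?; lra.
have -> : o1 = ~~ o1' by move: oo; case: o1; case: o1'.
by case/orP: uv => /eqP; case: o1'; case: o2'; rewrite /sg /=; lra.
Qed.

(** As [z] is positive, the sign of [l] alone determines the direction after the reversal. *)
Lemma edge_eq : k1 = k2 -> l1 = l2 -> o1' = o2'.
Proof using All.
have [x1 [z1 [-> -> x1_ge0 /andP[z1_gt0 z1_le] _]]] := form1.
have [x2 [z2 [-> -> x2_ge0 /andP[z2_gt0 z2_le] _]]] := form2.
by move=> _; case: o1'; case: o2' => //; rewrite /sg => h; exfalso; lra.
Qed.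

End Edge.

(** * Decompositions on the whole ground set *)

Section Decomposition.
Context (R : realType) (n : nat).
Implicit Types (P : 'M[R]_n) (p q u v w c d : 'cV[R]_n) (C B : {set 'I_n}).
Implicit Types (s : {set 'I_n} -> 'cV[R]_n) (O : orientation n) (e : 'I_n).

(** [c] and [d] stand for the sums of the reversed circuits and cocircuits. A single mark [t] at
    each element expresses that their supports are disjoint and that both agree with [O']. *)
Definition reversed O' c d O : Prop := forall e, exists t,
  [/\ c e 0 = cpart R t (O' e), d e 0 = dpart R t (O' e) & O e = flip t (O' e)].

Definition ldecomp P s s' O O' B c d : Prop :=
  [/\ lbasis P B, fund_agree P s B O', fund_agree (1%:M - P) s' (~: B) O',
      P *m c = c /\ (1%:M - P) *m d = d & reversed O' c d O].

Definition phi_set B c d : {set 'I_n} := (B :|: supp c) :\: supp d.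

Lemma sg_neq0 o : sg R o != 0.
Proof. by case: o; rewrite /sg ?oppr_eq0 oner_eq0. Qed.

Lemma in_phi_set O' B c d t e :
    c e 0 = cpart R t (O' e) -> d e 0 = dpart R t (O' e) ->
  (e \in phi_set B c d) = chosen t (e \in B).
Proof.
rewrite in_setD in_setU !in_supp => -> ->.
by case: t => [[]|]; rewrite /cpart /dpart /chosen ?sg_neq0 ?eqxx /= ?orbT ?orbF.
Qed.

Lemma cert_entryP P p q B O k l : certificate P p B O k ->
    certificate (1%:M - P) q (~: B) O l ->
  forall e, cert_entry (e \in B) (O e) (k e 0) (l e 0).
Proof.
move=> [_ kB kO] [_ lB lO] e; rewrite /cert_entry.
have := lB e; have := lO e; have := kB e; have := kO e.
by rewrite in_setC; case: (e \in B) => /= h1 h2 h3 h4; split; auto.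
Qed.

(** The two cones bound [dot p u] from both sides by zero, which is the equality case of
    [certificate_cone]. *)
Lemma cone_unique P p B1 B2 O1 O2 k1 k2 u : proj P ->
    lbasis P B1 -> lbasis P B2 ->
    certificate P p B1 O1 k1 -> certificate P p B2 O2 k2 -> P *m u = u ->
    (forall e, e \notin B1 -> 0 <= osign R O1 e * u e 0) ->
    (forall e, e \notin B2 -> 0 <= osign R O2 e * (- u) e 0) ->
  u = 0.
Proof.
move=> P_proj B1_basis B2_basis cert1 cert2 Pu uO1 uO2.
have [_] := certificate_cone P_proj B1_basis cert1 Pu uO1; apply.
have [] := certificate_cone P_proj B2_basis cert2 (fixN Pu) uO2.
by rewrite dotNr oppr_ge0.
Qed.

Context (P : 'M[R]_n) (s s' : {set 'I_n} -> 'cV[R]_n) (p q : 'cV[R]_n).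
Hypotheses (P_proj : proj P).
Hypotheses (s_sig : signature P s) (s'_sig : signature (1%:M - P) s').
Hypotheses (p_pos : positive P s p) (q_pos : positive (1%:M - P) s' q).

Let Q_proj : proj (1%:M - P) := proj_compl P_proj.

(* Let [k_i = N d_i + kappa_i] and [l_i = N c_i + lambda_i] for certificates
   [kappa_i] and [lambda_i] and a large [N]. The orthogonal vectors [k1 - k2] and
   [l1 - l2] have entries of opposite signs, so at every element one of them
   vanishes. This places them in the cones of both bases, up to sign, so that
   both are zero. *)
Lemma ldecomp_inj O1 O1' B1 c1 d1 O2 O2' B2 c2 d2 :
    ldecomp P s s' O1 O1' B1 c1 d1 -> ldecomp P s s' O2 O2' B2 c2 d2 ->
    phi_set B1 c1 d1 = phi_set B2 c2 d2 ->
  O1 = O2.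
Proof using All.
move=> [B1_basis B1_s B1_s' [Pc1 Qd1] rev1] [B2_basis B2_s B2_s' [Pc2 Qd2] rev2] same.
have B1c_basis := lbasis_compl B1_basis.
have B2c_basis := lbasis_compl B2_basis.
have [k1 cert_k1] := certificate_exists P_proj s_sig p_pos B1_basis B1_s.
have [k2 cert_k2] := certificate_exists P_proj s_sig p_pos B2_basis B2_s.
have [l1 cert_l1] := certificate_exists Q_proj s'_sig q_pos B1c_basis B1_s'.
have [l2 cert_l2] := certificate_exists Q_proj s'_sig q_pos B2c_basis B2_s'.
have [Qk1 _ _] := cert_k1; have [Qk2 _ _] := cert_k2.
have [Pl1 _ _] := cert_l1; have [Pl2 _ _] := cert_l2.
rewrite compl_complK in Pl1 Pl2.
pose N := 1 + 2 * \sum_e (`|k1 e 0| + `|k2 e 0| + `|l1 e 0| + `|l2 e 0|).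
have N_gt e : [/\ 2 * `|k1 e 0| < N, 2 * `|k2 e 0| < N,
                  2 * `|l1 e 0| < N & 2 * `|l2 e 0| < N].
  have : `|k1 e 0| + `|k2 e 0| + `|l1 e 0| + `|l2 e 0| <=
      \sum_e (`|k1 e 0| + `|k2 e 0| + `|l1 e 0| + `|l2 e 0|).
    rewrite [leRHS](bigD1 e) //= lerDl; apply: sumr_ge0 => i _.
    by rewrite !addr_ge0.
  have := normr_ge0 (k1 e 0); have := normr_ge0 (k2 e 0).
  have := normr_ge0 (l1 e 0); have := normr_ge0 (l2 e 0).
  rewrite /N; move: (\sum_e _) `|k1 e 0| `|k2 e 0| `|l1 e 0| `|l2 e 0|.
  by move=> *; split; lra.
pose u := (N *: d1 + k1) - (N *: d2 + k2).
pose v := (N *: c1 + l1) - (N *: c2 + l2).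
(* Only [k1 + p] and [k2 + p] are known to be fixed, but [p] cancels in the difference. *)
have Qu : (1%:M - P) *m u = u.
  rewrite (_ : u = N *: (d1 - d2) + ((k1 + p) - (k2 + p))); last first.
    by apply/matrixP => i j; rewrite !mxE; ring.
  by rewrite fixD ?fixZ ?fixB.
have Pv : P *m v = v.
  rewrite (_ : v = N *: (c1 - c2) + ((l1 + q) - (l2 + q))); last first.
    by apply/matrixP => i j; rewrite !mxE; ring.
  by rewrite fixD ?fixZ ?fixB.
have uE e : u e 0 = (N * d1 e 0 + k1 e 0) - (N * d2 e 0 + k2 e 0) by rewrite !mxE.
have vE e : v e 0 = (N * c1 e 0 + l1 e 0) - (N * c2 e 0 + l2 e 0) by rewrite !mxE.
(* Equal images give equal values of [chosen] at [e], so the same alternative of [cert_entry_form]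
   holds for both decompositions. *)
have forms e :
    (edge_form N (e \in B1) (O1' e) (O1 e) (N * d1 e 0 + k1 e 0) (N * c1 e 0 + l1 e 0) /\
     edge_form N (e \in B2) (O2' e) (O2 e) (N * d2 e 0 + k2 e 0) (N * c2 e 0 + l2 e 0)) \/
    (edge_form N (e \notin B1) (O1' e) (O1 e) (N * c1 e 0 + l1 e 0) (N * d1 e 0 + k1 e 0) /\
     edge_form N (e \notin B2) (O2' e) (O2 e) (N * c2 e 0 + l2 e 0) (N * d2 e 0 + k2 e 0)).
  have [t1 [c1E d1E ->]] := rev1 e; have [t2 [c2E d2E ->]] := rev2 e.
  have := congr1 (fun S : {set 'I_n} => e \in S) same.
  rewrite /= (in_phi_set _ c1E d1E) (in_phi_set _ c2E d2E) => ch.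
  have [Nk1 Nk2 Nl1 Nl2] := N_gt e.
  have := cert_entry_form t1 (cert_entryP cert_k1 cert_l1 e) Nk1 Nl1.
  have := cert_entry_form t2 (cert_entryP cert_k2 cert_l2 e) Nk2 Nl2.
  by rewrite /= -ch c1E c2E d1E d2E; case: ifP => _; [left|right].
have uv0 e : u e 0 * v e 0 = 0.
  suff /(_ e) : forall i, u i 0 * (- v) i 0 = 0.
    by rewrite [(- v) e 0]mxE mulrN => /eqP; rewrite oppr_eq0 => /eqP.
  apply: dot_ge0_eq0 => [i|].
    rewrite [(- v) i 0]mxE mulrN oppr_ge0 uE vE; case: (forms i) => -[f1 f2].
      exact: edge_le0 f1 f2.
    by rewrite mulrC; apply: edge_le0 f1 f2.
  by rewrite dotNr dotC (fix_orth P_proj Pv Qu) oppr0.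
have cones e : [/\ e \in B1 -> 0 <= osign R O1' e * u e 0,
    e \in B2 -> 0 <= osign R O2' e * (- u) e 0,
    e \notin B1 -> 0 <= osign R O1' e * v e 0 &
    e \notin B2 -> 0 <= osign R O2' e * (- v) e 0].
  rewrite [(- u) e 0]mxE [(- v) e 0]mxE; have := uv0 e; rewrite uE vE => uv.
  have vu := etrans (mulrC _ _) uv.
  have uvN := uv; rewrite -mulrNN !opprB in uvN; have vuN := etrans (mulrC _ _) uvN.
  rewrite !opprB; case: (forms e) => -[f1 f2].
    have [? ?] := edge_cone f1 f2 uv; have [? ?] := edge_cone f2 f1 uvN.
    by split.
  have := edge_cone f1 f2 vu; have := edge_cone f2 f1 vuN.
  by rewrite !negbK => -[? ?] [? ?]; split.
have u0 : u = 0.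
  apply: (cone_unique Q_proj B1c_basis B2c_basis cert_l1 cert_l2 Qu) => e;
    by rewrite in_setC negbK; have [] := cones e.
have v0 : v = 0.
  apply: (cone_unique P_proj B1_basis B2_basis cert_k1 cert_k2 Pv) => e;
    by have [] := cones e.
apply/ffunP => e.
have := uE e; rewrite u0 mxE => /esym/eqP; rewrite subr_eq0 => /eqP k12.
have := vE e; rewrite v0 mxE => /esym/eqP; rewrite subr_eq0 => /eqP l12.
by case: (forms e) => -[f1 f2]; apply: edge_eq f1 f2 _ _.
Qed.

(** The differences of the certificates are orthogonal with nonnegative entrywise products, and an
    element of exactly one of the two bases would make its product positive. *)
Lemma basis_unique B1 B2 O : lbasis P B1 -> lbasis P B2 ->
    fund_agree P s B1 O -> fund_agree (1%:M - P) s' (~: B1) O ->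
    fund_agree P s B2 O -> fund_agree (1%:M - P) s' (~: B2) O ->
  B1 = B2.
Proof using All.
move=> B1_basis B2_basis B1_s B1_s' B2_s B2_s'.
have B1c_basis := lbasis_compl B1_basis.
have B2c_basis := lbasis_compl B2_basis.
have [k1 cert_k1] := certificate_exists P_proj s_sig p_pos B1_basis B1_s.
have [k2 cert_k2] := certificate_exists P_proj s_sig p_pos B2_basis B2_s.
have [l1 cert_l1] := certificate_exists Q_proj s'_sig q_pos B1c_basis B1_s'.
have [l2 cert_l2] := certificate_exists Q_proj s'_sig q_pos B2c_basis B2_s'.
have [Qk1 _ _] := cert_k1; have [Qk2 _ _] := cert_k2.
have [Pl1 _ _] := cert_l1; have [Pl2 _ _] := cert_l2.
rewrite compl_complK in Pl1 Pl2.
have Qk : (1%:M - P) *m (k2 - k1) = k2 - k1.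
  by rewrite -(addrK p k2) -addrA -opprD [p + _]addrC fixB.
have Pl : P *m (l1 - l2) = l1 - l2.
  by rewrite -(addrK q l1) -addrA -opprD [q + _]addrC fixB.
have ent1 := cert_entryP cert_k1 cert_l1.
have ent2 := cert_entryP cert_k2 cert_l2.
have kl0 : forall e, (l1 - l2) e 0 * (k2 - k1) e 0 = 0.
  apply: dot_ge0_eq0 => [e|]; last by rewrite (fix_orth P_proj Pl Qk).
  rewrite !mxE; have := ent1 e; have := ent2 e; rewrite /cert_entry.
  by case: (e \in B1); case: (e \in B2); case: (O e);
    rewrite /sg => -[h1 h2] [h3 h4]; subst; nra.
apply/setP => e; have := kl0 e; rewrite !mxE.
have := ent1 e; have := ent2 e; rewrite /cert_entry.
by case: (e \in B1); case: (e \in B2) => //; case: (O e);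
  rewrite /sg => -[h1 h2] [h3 h4] h5; subst;
  (suff : (1 : R) < 0 by rewrite ltr10); nra.
Qed.

(** By orthogonality the entrywise products of [c1 - c2] and [d2 - d1] vanish. Then [c1 - c2] agrees
    with [O1'] and its negative with [O2'], so if it were nonzero [p] would be positive on both;
    likewise for [d1 - d2] and [q]. *)
Lemma compat_unique O O1' c1 d1 O2' c2 d2 :
    lcompat P s O1' -> lcompat (1%:M - P) s' O1' ->
    lcompat P s O2' -> lcompat (1%:M - P) s' O2' ->
    P *m c1 = c1 -> (1%:M - P) *m d1 = d1 -> P *m c2 = c2 ->
    (1%:M - P) *m d2 = d2 ->
    reversed O1' c1 d1 O -> reversed O2' c2 d2 O ->
  [/\ O1' = O2', c1 = c2 & d1 = d2].
Proof using All.
move=> O1_s O1_s' O2_s O2_s' Pc1 Qd1 Pc2 Qd2 rev1 rev2.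
have cd0 : forall e, (c1 - c2) e 0 * (d2 - d1) e 0 = 0.
  apply: dot_ge0_eq0 => [e|]; last by rewrite (fix_orth P_proj) ?fixB.
  rewrite !mxE; have [t1 [-> -> O1E]] := rev1 e; have [t2 [-> ->]] := rev2 e.
  rewrite O1E; case: t1 {O1E} => [[]|]; case: t2 => [[]|];
    case: (O1' e); case: (O2' e); rewrite /flip /cpart /dpart /sg //= => _; lra.
have cones e : [/\ 0 <= (c1 - c2) e 0 * osign R O1' e,
    0 <= (c2 - c1) e 0 * osign R O2' e,
    0 <= (d1 - d2) e 0 * osign R O1' e & 0 <= (d2 - d1) e 0 * osign R O2' e].
  have := cd0 e; rewrite !mxE /osign.
  have [t1 [-> -> O1E]] := rev1 e; have [t2 [-> ->]] := rev2 e.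
  rewrite O1E; case: t1 {O1E} => [[]|]; case: t2 => [[]|];
    case: (O1' e); case: (O2' e); rewrite /flip /cpart /dpart /sg //= => _ h;
    split; lra.
have zero (T : 'M[R]_n) f x (a b : 'cV[R]_n) : signature T f -> positive T f x ->
    lcompat T f O1' -> lcompat T f O2' -> T *m a = a -> T *m b = b ->
    (forall e, 0 <= (a - b) e 0 * osign R O1' e) ->
    (forall e, 0 <= (b - a) e 0 * osign R O2' e) -> a = b.
  move=> f_sig x_pos O1_f O2_f Ta Tb ab ba.
  apply/eqP; rewrite -subr_eq0; apply/negPn/negP => ab_n0.
  have ba_n0 : b - a != 0 by rewrite -oppr_eq0 opprB.
  have := compat_pos f_sig x_pos O1_f (fixB Ta Tb) ab_n0 ab.
  have := compat_pos f_sig x_pos O2_f (fixB Tb Ta) ba_n0 ba.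
  by rewrite !dotBr; lra.
have c12 : c1 = c2.
  by apply: (zero P s p) => // e; have [] := cones e.
have d12 : d1 = d2.
  by apply: (zero (1%:M - P) s' q) => // e; have [] := cones e.
split=> //; apply/ffunP => e.
have [t1 [c1E d1E O1E]] := rev1 e; have [t2 []] := rev2 e.
rewrite -c12 -d12 c1E d1E O1E; case: t1 {c1E d1E O1E} => [[]|]; case: t2 => [[]|];
  case: (O1' e); case: (O2' e); rewrite /flip /cpart /dpart /sg //= => *;
  (suff : (1 : R) < 0 by rewrite ltr10); lra.
Qed.

Lemma flip_signed v O : sign_vector v -> in_orientation v O ->
  exists O1, forall e, osign R O1 e = osign R O e - 2 * v e 0.
Proof.
move=> sv /(in_orientationP _ sv) vO.
exists [ffun e => if v e 0 == 0 then O e else ~~ O e] => e.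
rewrite /osign ffunE; case: eqP => [->|/eqP v_n0]; first by rewrite mulr0 subr0.
case: (vO e) => ve; first by rewrite ve eqxx in v_n0.
by rewrite ve /osign /sg; case: (O e) => /=; lra.
Qed.

Lemma incompat_signed (T : 'M[R]_n) f x O : signature T f -> positive T f x ->
    ~ lcompat T f O ->
  exists v, [/\ T *m v = v, sign_vector v, in_orientation v O & dot x v < 0].
Proof.
move=> f_sig [_ x_pos] /existsNP[C /existsNP[v]].
move=> /not_implyP[v_signed /not_implyP[vO v_f]].
have [C_circ sv Tv _] := v_signed; exists v; split=> //.
case: (lsigned_unique v_signed (f_sig _ C_circ)) => // ->.
by rewrite dotNr oppr_lt0 x_pos.
Qed.

(** Integrality, unlike having entries 0, 1 and -1, is visibly preserved by successive reversals. *)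
Definition int_vector v := forall e, exists m : int, v e 0 = m%:~R.

Lemma int_vectorB u v : int_vector u -> int_vector v -> int_vector (u - v).
Proof.
move=> iu iv e; have [a ua] := iu e; have [b vb] := iv e.
by exists (a - b); rewrite !mxE ua vb rmorphB.
Qed.

Lemma sign_int_vector v : sign_vector v -> int_vector v.
Proof.
move=> sv e; case: (sign_vectorP e sv) => ->; [by exists 0|by exists 1|].
by exists (-1); rewrite rmorphN.
Qed.

(* Reversing a signed circuit or cocircuit that violates compatibility increases
   the value of [p + q] on the orientation. *)
Lemma compat_exists O : exists O' c d,
  [/\ lcompat P s O', lcompat (1%:M - P) s' O', P *m c = c,
      (1%:M - P) *m d = d & reversed O' c d O].
Proof using All.
have [Pp _] := p_pos; have [Qq _] := q_pos.
(* A relaxed reversal class: the differences are integral vectors of the two fixed spaces. The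
   factors 2 come from the coordinates 1 and -1. *)
pose reach O' := exists c d, [/\ P *m c = c /\ int_vector c,
  (1%:M - P) *m d = d /\ int_vector d &
  forall e, osign R O e = osign R O' e - 2 * c e 0 - 2 * d e 0].
pose val O' : R := dot (p + q) (\col_e osign R O' e).
have O_reach : `[< reach O >].
  apply/asboolP; exists 0, 0; split; last by move=> e; rewrite !mxE; lra.
    by split; [rewrite mulmx0 | move=> e; exists 0; rewrite mxE].
  by split; [rewrite mulmx0 | move=> e; exists 0; rewrite mxE].
have [O' /asboolP[c [d [[Pc ic] [Qd id] OE]]] O'_max] :=
  @arg_maxP _ _ _ O (fun O' => `[< reach O' >]) val O_reach.
have max_dot v : sign_vector v -> in_orientation v O' ->
    (forall O1, (forall e, osign R O1 e = osign R O' e - 2 * v e 0) -> reach O1) ->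
    0 <= dot (p + q) v.
  move=> sv vO' reach1; have [O1 O1E] := flip_signed sv vO'.
  have : val O1 <= val O' by apply: O'_max; apply/asboolP/reach1.
  rewrite /val (_ : \col_e osign R O1 e = \col_e osign R O' e - 2 *: v).
    by rewrite dotBr dotZr gerBl pmulr_rge0.
  by apply/matrixP => i j; rewrite !mxE ord1 O1E.
exists O', c, d; split=> //.
- apply: contrapT => /(incompat_signed s_sig p_pos)[v [Pv sv vO' v_lt0]].
  have : 0 <= dot (p + q) v.
    apply: max_dot => // O1 O1E; exists (c - v), d; split=> // [|e].
      by split; [rewrite fixB | apply/int_vectorB/sign_int_vector].
    by rewrite O1E OE !mxE; lra.
  by rewrite dotDl (dotC q) (fix_orth P_proj Pv Qq); lra.
- apply: contrapT => /(incompat_signed s'_sig q_pos)[v [Qv sv vO' v_lt0]].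
  have : 0 <= dot (p + q) v.
    apply: max_dot => // O1 O1E; exists c, (d - v); split=> // [|e].
      by split; [rewrite fixB | apply/int_vectorB/sign_int_vector].
    by rewrite O1E OE !mxE; lra.
  by rewrite dotDl (fix_orth P_proj Pp Qv); lra.
(* Two integers with sum 0, 1 or -1 have a nonpositive product, and the products sum to zero. So
   each change of direction is due to only one of [c] and [d]. *)
have cd0 e : c e 0 * d e 0 = 0.
  suff /(_ e) : forall i, c i 0 * (- d) i 0 = 0.
    by rewrite mxE mulrN => /eqP; rewrite oppr_eq0 => /eqP.
  apply: dot_ge0_eq0 => [i|]; last first.
    by rewrite dotNr (fix_orth P_proj Pc Qd) oppr0.
  rewrite mxE mulrN oppr_ge0; have [a ca] := ic i; have [b db] := id i.
  have cdE := OE i; rewrite ca db in cdE *; rewrite -intrM lerz0.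
  have : [\/ a + b = 0, a + b = 1 | a + b = -1].
    have [ab|ab|ab] : [\/ a%:~R + b%:~R = 0 :> R, a%:~R + b%:~R = 1 :> R |
                         a%:~R + b%:~R = -1 :> R].
    - move: cdE; case: (osignP R O i) => ->; case: (osignP R O' i) => -> h;
        [apply: Or31 | apply: Or33 | apply: Or32 | apply: Or31]; lra.
    - by apply: Or31; apply: (@intr_inj R); rewrite intrD ab.
    - by apply: Or32; apply: (@intr_inj R); rewrite intrD ab.
    - by apply: Or33; apply: (@intr_inj R); rewrite intrD ab rmorphN1.
  by case=> ab; nia.
move=> e; have := OE e; have /eqP := cd0 e; rewrite mulf_eq0 /osign.
case/orP => /eqP->; case: (O e); case: (O' e); rewrite /sg => h;
  first [ by exists None; rewrite /cpart /dpart /sg; split=> //; lra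
        | by exists (Some true); rewrite /cpart /dpart /sg; split=> //; lra
        | by exists (Some false); rewrite /cpart /dpart /sg; split=> //; lra].
Qed.

Lemma basis_exists O' : lcompat P s O' -> lcompat (1%:M - P) s' O' ->
  exists B, [/\ lbasis P B, fund_agree P s B O' &
                fund_agree (1%:M - P) s' (~: B) O'].
Proof using All.
move=> O'_s O'_s'.
have [x [y [Px Qy xO yO xy0]]] :=
  complementary_vertex P_proj s_sig s'_sig p_pos q_pos O'_s O'_s'.
have B_basis := vertex_basis P_proj s_sig s'_sig p_pos q_pos Px Qy xy0.
exists (supp x); split=> //.
  apply: vertex_agree P_proj s_sig p_pos B_basis Qy _ yO => e.
  rewrite in_supp => x_n0; have /eqP := xy0 e.
  by rewrite mulf_eq0 (negPf x_n0) => /eqP.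
apply: vertex_agree Q_proj s'_sig q_pos (lbasis_compl B_basis) _ _ xO.
  by rewrite compl_complK.
by move=> e; rewrite in_setC in_supp negbK => /eqP.
Qed.

End Decomposition.

(** * Reversals, and the matroid of a matrix *)

Section Reversal.
Context (R : realType) (n : nat).
Implicit Types (P : 'M[R]_n) (p u v w c d : 'cV[R]_n) (O : orientation n).

Lemma reversedC O' c d O : reversed O' c d O -> reversed O' d c O.
Proof.
move=> rev e; have [t [-> -> ->]] := rev e.
by exists (omap negb t); case: t => [[]|].
Qed.

(** [c] agrees with [O'] and [- c] with [O], so a nonzero [c] would make [p] positive on both. *)
Lemma compat_reversed0 P s p O' c d O : signature P s -> positive P s p ->
  lcompat P s O' -> lcompat P s O -> P *m c = c -> reversed O' c d O -> c = 0.
Proof.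
move=> s_sig p_pos O'_s O_s Pc rev; apply/eqP/negPn/negP => c_n0.
have := compat_pos s_sig p_pos O'_s Pc c_n0.
have := compat_pos s_sig p_pos O_s (fixN Pc); rewrite oppr_eq0 dotNr => /(_ c_n0).
move=> c_lt0 c_gt0; suff : (0 : R) < 0 by rewrite ltxx.
have cO : (forall e, 0 <= (- c) e 0 * osign R O e) /\
    (forall e, 0 <= c e 0 * osign R O' e).
  by split=> e; rewrite ?mxE /osign; have [t [-> _ OE]] := rev e; rewrite ?OE;
    case: t {OE} => [[]|]; case: (O' e); rewrite /cpart /flip /sg /=; lra.
by have := c_lt0 cO.1; have := c_gt0 cO.2; lra.
Qed.

(** On the support of [d], a signed circuit in [O] can only have the signs of [- d]. Being
    orthogonal to [d], it avoids this support and hence is also in [O']. *)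
Lemma reversed0_compat P s O' d O : proj P -> lcompat P s O' ->
  (1%:M - P) *m d = d -> reversed O' 0 d O -> lcompat P s O.
Proof.
move=> P_proj O'_s Qd rev C v v_signed vO; apply: O'_s (v_signed) _.
have [_ sv Pv _] := v_signed; move/(in_orientationP _ sv): vO => vO.
have rev0 e : exists2 t, d e 0 = dpart R t (O' e) &
    O e = flip t (O' e) /\ t <> Some true.
  have [t [c0 -> ->]] := rev e; exists t => //; split=> // t1.
  by move/eqP: c0; rewrite mxE t1 /cpart eq_sym (negPf (sg_neq0 _ _)).
have vd0 : forall e, v e 0 * (- d) e 0 = 0.
  apply: dot_ge0_eq0 => [e|]; last by rewrite dotNr (fix_orth P_proj Pv Qd) oppr0.
  rewrite mxE; have [t -> [OE _]] := rev0 e; have := vO e; rewrite /osign OE.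
  by case: t {OE} => [[]|]; case: (O' e); rewrite /flip /dpart /sg /=;
    case=> ->; lra.
apply/in_orientationP => // e; have := vd0 e; rewrite mxE; have := vO e.
have [t -> []] := rev0 e; rewrite /osign => ->.
case: t => [[]|] // _; first by move=> _ /eqP;
  rewrite mulf_eq0 oppr_eq0 /dpart (negPf (sg_neq0 _ _)) orbF => /eqP; left.
Qed.

Lemma reversed_sign c d O' O : reversed O' c d O -> sign_vector c.
Proof.
move=> rev; apply/forallP => e; have [t [-> _ _]] := rev e.
by rewrite !inE /cpart /sg; case: t => [[]|]; case: (O' e); rewrite eqxx ?orbT.
Qed.

Lemma supp_unionP (vs : seq 'cV[R]_n) e :
  reflect (exists2 v, v \in vs & e \in supp v) (e \in supp_union vs).
Proof.
rewrite /supp_union; elim: vs => [|v vs IHvs].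
  by rewrite big_nil inE; constructor=> -[].
rewrite big_cons in_setU; apply: (iffP orP) => [[ev|/IHvs[w wvs ew]]|].
- by exists v; rewrite ?mem_head.
- by exists w; rewrite // in_cons wvs orbT.
case=> w; rewrite in_cons => /orP[/eqP->|wvs] ew; first by left.
by right; apply/IHvs; exists w.
Qed.

Lemma sum_disjoint O (vs : seq 'cV[R]_n) e :
    pairwise (fun u v => [disjoint supp u & supp v]) vs ->
    (forall v, v \in vs -> sign_vector v /\ in_orientation v O) ->
  (\sum_(v <- vs) v) e 0 = if e \in supp_union vs then osign R O e else 0.
Proof.
rewrite /supp_union; elim: vs => [|v vs IHvs]; first by rewrite !big_nil inE mxE.
rewrite /= !big_cons => /andP[/allP v_disj vs_disj] vsO.
rewrite mxE in_setU IHvs //; last by move=> w wvs; apply: vsO; rewrite in_cons wvs orbT.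
have [sv /(in_orientationP _ sv)/(_ e)] := vsO v (mem_head v vs).
rewrite in_supp; have [->|v_n0 [/eqP|->]] := eqVneq (v e 0) 0.
- by rewrite add0r.
- by rewrite (negPf v_n0).
case: ifP => [/supp_unionP[w wvs ew]|_]; last by rewrite addr0.
have := v_disj w wvs; rewrite disjoints_subset => /subsetP/(_ e).
by rewrite in_setC ew in_supp v_n0 => /(_ isT).
Qed.

End Reversal.

(** * Transfer to the matroid represented by [A] *)

Section Represented.
Context (R : realType) (r n : nat) (A : 'M[R]_(r, n)) (M : matroid 'I_n).
Hypotheses (A_rank : \rank A = r) (A_represents : represents A M).

(** The orthogonal projection onto the kernel of [A]; the subtracted term is the projection onto the
    row space. *)
Definition ker_proj : 'M[R]_n := 1%:M - A^T *m invmx (A *m A^T) *m A.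
Local Notation P := ker_proj.

Lemma gram_unit : A *m A^T \in unitmx.
Proof using A_rank.
rewrite -row_free_unit -kermx_eq0; apply/eqP/row_matrixP => i; rewrite row0.
set x := row i _; have : x *m (A *m A^T) = 0.
  by rewrite -row_mul mulmx_ker row0.
move=> xG; have A_free : row_free A by rewrite /row_free A_rank.
apply: (row_free_inj A_free); rewrite mul0mx; apply: trmx_inj; rewrite trmx0.
apply: dot_eq0; rewrite dotE trmxK trmx_mul mulmxA -(mulmxA x) xG mul0mx.
by rewrite mxE.
Qed.

Lemma ker_proj_proj : proj P.
Proof using A_rank.
apply: proj_compl.
split; first by rewrite !trmx_mul trmxK trmx_inv trmx_mul trmxK mulmxA.
by rewrite -!mulmxA (mulmxA A) (mulmxA (invmx _)) mulVmx ?gram_unit // mul1mx.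
Qed.

Lemma fix_kerP (v : 'cV[R]_n) : P *m v = v <-> A *m v = 0.
Proof using A_rank.
rewrite fix_compl -!mulmxA; split=> [/(congr1 (mulmx A))|->]; last by rewrite !mulmx0.
by rewrite mulmx0 !mulmxA mulmxV ?gram_unit // mul1mx.
Qed.

Lemma fix_imP (w : 'cV[R]_n) :
  (1%:M - P) *m w = w <-> exists u : 'cV[R]_r, w = A^T *m u.
Proof using A_rank.
rewrite compl_complK; split=> [<-|[u ->]].
  by exists (invmx (A *m A^T) *m (A *m w)); rewrite !mulmxA.
by rewrite -!mulmxA (mulmxA A) (mulmxA (invmx _)) mulVmx ?gram_unit // mul1mx.
Qed.

(** A linear relation among the columns indexed by [I] is a kernel vector supported in [I], after
    reindexing by [enum_val]. *)
Lemma indepE I : indep M I = ~~ ldep P I.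
Proof using A_rank A_represents.
rewrite A_represents -mxrank_tr -/(row_free _) -kermx_eq0.
set X := colsub _ A; apply/eqP/idP => [X_ker|].
  apply/negP => /ldepP[v [/fix_kerP Av v_n0 /suppP vI]]; case/eqP: v_n0.
  pose y : 'rV[R]_#|I| := \row_k v (enum_val k) 0.
  have : (y <= kermx X^T)%MS.
    apply/sub_kermxP/matrixP => k i; rewrite ord1 !mxE.
    transitivity ((A *m v) i 0); last by rewrite Av mxE.
    rewrite mxE [RHS](bigID (fun j => j \in I)) /= [X in _ + X]big1 ?addr0 => [|j /vI->]; last first.
      by rewrite mulr0.
    by rewrite [RHS]big_enum_val; apply: eq_bigr => j _; rewrite !mxE mulrC.
  rewrite X_ker submx0 => /eqP y0; apply/matrixP => e j; rewrite ord1 mxE.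
  have [eI|/vI//] := boolP (e \in I).
  have := congr1 (fun z : 'rV_#|I| => z 0 (enum_rank_in eI e)) y0.
  by rewrite !mxE enum_rankK_in.
move=> I_indep; apply/row_matrixP => i; rewrite row0.
set y := row i _; have yX : y *m X^T = 0 by rewrite -row_mul mulmx_ker row0.
pose v : 'cV[R]_n := \col_e \sum_k (enum_val k == e)%:R * y 0 k.
have vE k : v (enum_val k) 0 = y 0 k.
  rewrite mxE (bigD1 k) //= eqxx mul1r big1 ?addr0 // => j /negPf jk.
  by rewrite (inj_eq enum_val_inj) jk mul0r.
have v_supp : supp v \subset I.
  apply/suppP => e eI; rewrite mxE big1 // => k _.
  by case: eqP => [ke|_]; rewrite ?mul0r //; rewrite -ke enum_valP in eI.
suff v0 : v = 0 by apply/rowP => k; rewrite -vE v0 !mxE.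
apply/eqP; apply: contraNT I_indep => v_n0; apply/ldepP; exists v; split=> //.
apply/fix_kerP/matrixP => j k; rewrite ord1 !mxE.
rewrite (bigID (fun j => j \in I)) /= [X in _ + X]big1 ?addr0 => [|e eI]; last first.
  by rewrite (suppP _ _ v_supp) // mulr0.
rewrite [LHS]big_enum_val.
have := congr1 (fun z : 'rV_r => z 0 j) yX; rewrite !mxE; apply: etrans.
by apply: eq_bigr => e _; rewrite vE !mxE mulrC.
Qed.

(** If [B] is maximal, a row space vector supported off [B] meets the support of a kernel vector
    through [e] inside [e |: B] in at most [e], so orthogonality kills its entry there. Conversely,
    maximality follows from [dichotomy]. *)
Lemma is_basisP B : reflect (lbasis P B) (is_basis M B).
Proof using A_rank A_represents.
have P_proj := ker_proj_proj.
apply: (iffP maxsetP) => [[B_indep B_max]|[B_indep B_span]]; split.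
- move=> v Pv vB; apply/eqP; move: B_indep; rewrite indepE; apply: contraNT => v_n0.
  by apply/ldepP; exists v.
- move=> w Qw wB; apply/eqP; rewrite -supp_eq0; apply/eqP/setP => e.
  rewrite in_set0 in_supp; apply/negbTE; rewrite negbK; apply/eqP.
  have [eB|eB] := boolP (e \in B).
    by have /suppP/(_ e) := wB; rewrite in_setC negbK => ->.
  have /ldepP[v [Pv v_n0 vB]] : ldep P (e |: B).
    rewrite -[ldep _ _]negbK -indepE; apply: contra eB => eB_indep.
    by rewrite -(B_max _ eB_indep (subsetUr _ _)) setU11.
  have ve : v e 0 != 0.
    apply: contraNneq v_n0 => ve; move: B_indep; rewrite indepE.
    apply: contraNT => v_n0; apply/ldepP; exists v; split=> //.
    apply/suppP => i iB; have [->//|ie] := eqVneq i e.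
    by have /suppP/(_ i) -> := vB; rewrite // in_setU1 negb_or ie.
  have := fix_orth P_proj Pv Qw; rewrite /dot (bigD1 e) //= big1 => [|i ie].
    by rewrite addr0 => /eqP; rewrite mulf_eq0 (negPf ve) => /eqP.
  have [iB|iB] := boolP (i \in B).
    by have /suppP/(_ i) -> := wB; rewrite ?mulr0 // in_setC negbK.
  by have /suppP/(_ i) -> := vB; rewrite ?mul0r // in_setU1 negb_or ie.
- by rewrite indepE; apply/ldepP => -[v [Pv /eqP v_n0 vB]]; apply/v_n0/B_indep.
move=> B2; rewrite indepE => /ldepP B2_indep BB2; apply/eqP.
rewrite eqEsubset BB2 andbT; apply/subsetP => e eB2; apply: contraT => eB.
have [[v [Pv ve vB]]|[w [Qw we wB]]] := dichotomy P_proj eB.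
  case: B2_indep; exists v; split=> //.
    by apply: contra_eq_neq ve => ->; rewrite mxE eq_sym oner_eq0.
  by apply: subset_trans vB _; rewrite subUset sub1set eB2.
by move/eqP: we; rewrite (B_span w Qw wB) mxE eq_sym oner_eq0.
Qed.

(** The required basis is a maximal independent set [I] avoiding [D]. A row space vector supported
    off [I] must be supported in [D], since by [dichotomy] an element elsewhere in its support would
    contradict orthogonality or enlarge [I]. *)
Lemma coindepE D : coindep M D = ~~ ldep (1%:M - P) D.
Proof using A_rank A_represents.
have P_proj := ker_proj_proj.
apply/existsP/idP => [[B /andP[/is_basisP[_ B_span] DB]]|/ldepP D_indep].
  apply/ldepP => -[w [Qw /eqP w_n0 wD]].
  by apply/w_n0/B_span => //; apply: subset_trans wD DB.
have [|I /maxsetP[/andP[I_indep ID] I_max] _] :=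
    @maxset_exists _ (fun I => indep M I && (I \subset ~: D)) set0.
  by rewrite indep_set0 sub0set.
exists I; apply/andP; split; last by rewrite subsetC.
move: (I_indep); rewrite indepE => /ldepP I_free.
apply/is_basisP; split=> [v Pv vI|w Qw wI].
  by apply/eqP/negPn/negP => v_n0; apply: I_free; exists v.
apply/eqP/negPn/negP => w_n0; apply: D_indep; exists w; split=> //.
apply/suppP => e eD; apply/eqP; apply: contraT => we.
have eI : e \notin I.
  by apply: contra we => eI; have /suppP/(_ e) -> := wI; rewrite ?in_setC ?eI.
have [[v [Pv ve vI]]|[w' [Qw' we' w'I]]] := dichotomy P_proj eI.
  have := fix_orth P_proj Pv Qw; rewrite /dot (bigD1 e) //= big1 => [|i ie].
    by rewrite addr0 ve mul1r => /eqP; rewrite (negPf we).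
  have [iI|iI] := boolP (i \in I).
    by have /suppP/(_ i) -> := wI; rewrite ?mulr0 // in_setC negbK.
  by have /suppP/(_ i) -> := vI; rewrite ?mul0r // in_setU1 negb_or ie.
have eI_indep : indep M (e |: I).
  rewrite indepE; apply/ldepP => -[v [Pv v_n0 vI]]; apply: I_free; exists v.
  split=> //; apply/suppP => i iI; have [->|ie] := eqVneq i e; last first.
    by have /suppP/(_ i) -> := vI; rewrite // in_setU1 negb_or ie.
  have := fix_orth P_proj Pv Qw'; rewrite /dot (bigD1 e) //= big1 => [|j je].
    by rewrite addr0 we' mulr1.
  have [jI|jI] := boolP (j \in I).
    by have /suppP/(_ j) -> := w'I; rewrite ?mulr0 // in_setC negbK.
  by have /suppP/(_ j) -> := vI; rewrite ?mul0r // in_setU1 negb_or je.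
move: eI; rewrite -(I_max (e |: I)) ?subsetUr ?setU11 //.
by rewrite eI_indep subUset ID sub1set in_setC eD.
Qed.

Lemma is_circuitE : is_circuit M = lcirc P.
Proof using A_rank A_represents.
apply/funext => C; rewrite /is_circuit /lcirc; congr (minset _ C).
by apply/funext => D; rewrite indepE negbK.
Qed.

Lemma is_cocircuitE : is_cocircuit M = lcirc (1%:M - P).
Proof using A_rank A_represents.
apply/funext => C; rewrite /is_cocircuit /lcirc; congr (minset _ C).
by apply/funext => D; rewrite coindepE negbK.
Qed.

Lemma signed_circuitP C v : signed_circuit A M C v <-> lsigned P C v.
Proof using A_rank A_represents.
rewrite /signed_circuit /lsigned is_circuitE.
by split=> -[? ? /fix_kerP ? ?].
Qed.

Lemma signed_cocircuitP C v : signed_cocircuit A M C v <-> lsigned (1%:M - P) C v.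
Proof using A_rank A_represents.
rewrite /signed_cocircuit /lsigned is_cocircuitE.
by split=> -[? ? /fix_imP ? ?].
Qed.

Lemma circuit_compatibleP s O : circuit_compatible A M s O <-> lcompat P s O.
Proof using A_rank A_represents.
by split=> O_s C v /signed_circuitP; apply: O_s.
Qed.

Lemma cocircuit_compatibleP s O :
  cocircuit_compatible A M s O <-> lcompat (1%:M - P) s O.
Proof using A_rank A_represents.
by split=> O_s C v /signed_cocircuitP; apply: O_s.
Qed.

Context (s s' : {set 'I_n} -> 'cV[R]_n).
Hypotheses (s_sig : signature P s) (s'_sig : signature (1%:M - P) s').

Lemma bbygP B O : lbasis P B ->
  bbyg M s s' B = O <-> fund_agree P s B O /\ fund_agree (1%:M - P) s' (~: B) O.
Proof using All.
move=> B_basis; have P_proj := ker_proj_proj.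
have Bc_basis := lbasis_compl B_basis; have Q_proj := proj_compl P_proj.
have fundE e : fund_circuit M B e = lfund P B e.
  by rewrite /fund_circuit /lfund is_circuitE.
have cofundE e : fund_cocircuit M B e = lfund (1%:M - P) (~: B) e.
  by rewrite /fund_cocircuit /lfund is_cocircuitE.
have val1 (T : 'M[R]_n) f D e : proj T -> signature T f -> lbasis T D ->
    e \notin D -> f (lfund T D e) e 0 = 1 \/ f (lfund T D e) e 0 = -1.
  move=> T_proj f_sig D_basis eD.
  have [C_circ _ eC] := lfundP T_proj D_basis eD.
  have [_ sf _ fC] := f_sig _ C_circ.
  have : f (lfund T D e) e 0 != 0 by rewrite -in_supp fC.
  by case: (sign_vectorP e sf) => ->; rewrite ?eqxx //; [left|right].
have N11 : (-1 == 1 :> R) = false by rewrite lt_eqF // (lt_trans (ltrN10 R)) ?ltr01.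
have sgE (x : R) : x = 1 \/ x = -1 -> sg R (x == 1) = x.
  by case=> ->; rewrite /sg ?eqxx ?N11.
have sg1 o : (sg R o == 1) = o by case: o; rewrite /sg ?eqxx ?N11.
split=> [<-|[O_s O_s']].
  split=> e eB; rewrite /osign ffunE.
    by rewrite (negPf eB) fundE sgE //; apply: val1.
  by move: (eB); rewrite in_setC negbK => ->; rewrite cofundE sgE //; apply: val1.
apply/ffunP => e; rewrite ffunE; case: ifPn => eB.
  by rewrite cofundE O_s' ?in_setC ?negbK // /osign sg1.
by rewrite fundE O_s // /osign sg1.
Qed.

Lemma reversalP O' cs ds O : reversal A M O' cs ds O ->
  let c := \sum_(v <- cs) v in let d := \sum_(v <- ds) v in
  [/\ P *m c = c, (1%:M - P) *m d = d, reversed O' c d O,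
      supp c = supp_union cs & supp d = supp_union ds].
Proof using A_rank A_represents.
move=> [cs_O ds_O + OE] c d; rewrite pairwise_cat => /and3P[/allrelP cd_disj cs_disj ds_disj].
have cE e : c e 0 = if e \in supp_union cs then osign R O' e else 0.
  apply: sum_disjoint => // v /cs_O[[C [_ ? _ _]]].
  by split.
have dE e : d e 0 = if e \in supp_union ds then osign R O' e else 0.
  apply: sum_disjoint => // v /ds_O[[C [_ ? _ _]]].
  by split.
have supp_sum (x : 'cV[R]_n) (D : {set 'I_n}) :
    (forall e, x e 0 = if e \in D then osign R O' e else 0) -> supp x = D.
  move=> xE; apply/setP => e; rewrite in_supp xE; case: ifP => _; last by rewrite eqxx.
  exact: sg_neq0.
split; [| | | exact: supp_sum | exact: supp_sum].
- by apply: fix_sum => v /cs_O[[C /signed_circuitP[]]].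
- by apply: fix_sum => v /ds_O[[C /signed_cocircuitP[]]].
have cd0 e : e \in supp_union cs -> e \in supp_union ds -> False.
  move=> /supp_unionP[v vcs ev] /supp_unionP[w wds ew].
  have := cd_disj v w vcs wds; rewrite disjoints_subset => /subsetP/(_ e ev).
  by rewrite in_setC ew.
move=> e; have : orientation_vec R O e 0 = orientation_vec R O' e 0 - c e 0 - d e 0.
  by rewrite OE [LHS]mxE [X in X + _]mxE [(- c) e 0]mxE [(- d) e 0]mxE.
rewrite !orientation_vecE cE dE; have := @cd0 e.
case: (e \in supp_union cs); case: (e \in supp_union ds) => cd0e OO'.
- by have := cd0e isT isT.
- exists (Some true); split=> //; move: OO'; rewrite /osign /sg /flip.
  by case: (O e); case: (O' e) => // ?; (suff : (1 : R) < 0 by rewrite ltr10); lra.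
- exists (Some false); split=> //; move: OO'; rewrite /osign /sg /flip.
  by case: (O e); case: (O' e) => // ?; (suff : (1 : R) < 0 by rewrite ltr10); lra.
- exists None; split=> //; move: OO'; rewrite /osign /sg /flip.
  by case: (O e); case: (O' e) => // ?; (suff : (1 : R) < 0 by rewrite ltr10); lra.
Qed.

(** The lists are the conformal decompositions of the sign vectors [c] and [d]. *)
Lemma reversal_exists O' c d O : P *m c = c -> (1%:M - P) *m d = d ->
  reversed O' c d O -> exists cs ds : seq 'cV[R]_n,
  [/\ reversal A M O' cs ds O, c = \sum_(v <- cs) v & d = \sum_(v <- ds) v].
Proof using All.
move=> Pc Qd rev; have sc := reversed_sign rev.
have sd := reversed_sign (reversedC rev).
have [cs [cs_c cs_disj cE]] := sign_vector_decomp s_sig Pc sc.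
have [ds [ds_d ds_disj dE]] := sign_vector_decomp s'_sig Qd sd.
exists cs, ds; split=> //; split.
- move=> v vcs; have [[C v_signed] vc] := cs_c v vcs.
  split; first by exists C; apply/signed_circuitP.
  have [_ sv _ _] := v_signed; apply/(in_orientationP _ sv) => e.
  case: (vc e) => ->; first by left.
  have [t [-> _ _]] := rev e.
  by case: t => [[]|]; rewrite /cpart; [right|left|left].
- move=> v vds; have [[C v_signed] vd] := ds_d v vds.
  split; first by exists C; apply/signed_cocircuitP.
  have [_ sv _ _] := v_signed; apply/(in_orientationP _ sv) => e.
  case: (vd e) => ->; first by left.
  have [t [_ -> _]] := rev e.
  by case: t => [[]|]; rewrite /dpart; [left|right|left].
- rewrite pairwise_cat cs_disj ds_disj !andbT; apply/allrelP => v w vcs wds.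
  rewrite disjoints_subset; apply/subsetP => e; rewrite in_setC !in_supp.
  have [_ /(_ e)] := cs_c v vcs; have [_ /(_ e)] := ds_d w wds.
  have [t [-> -> _]] := rev e; case: t => [[]|] [->|->] [->|->];
    by rewrite /cpart /dpart ?eqxx.
rewrite -cE -dE; apply/matrixP => e j; rewrite ord1.
rewrite [RHS]mxE [X in _ = X + _]mxE [(- c) e 0]mxE [(- d) e 0]mxE !orientation_vecE.
rewrite /osign; have [t [-> -> ->]] := rev e.
by case: t => [[]|]; case: (O' e); rewrite /cpart /dpart /flip /sg /=; lra.
Qed.

Lemma phi_graphP O S : phi_graph A M s s' O S <->
  exists O' B c d, [/\ lcompat P s O', lcompat (1%:M - P) s' O',
    ldecomp P s s' O O' B c d & S = phi_set B c d].
Proof using All.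
split=> [[O' [B [cs [ds [[O'_s O'_s' rev B_basis BO'] ->]]]]]|].
  move/is_basisP: B_basis => B_basis.
  have [Pc Qd rev' c_supp d_supp] := reversalP rev.
  have [B_s B_s'] := (bbygP O' B_basis).1 BO'.
  exists O', B, (\sum_(v <- cs) v), (\sum_(v <- ds) v); split.
  - exact/circuit_compatibleP.
  - exact/cocircuit_compatibleP.
  - by split.
  - by rewrite /phi_set c_supp d_supp.
move=> [O' [B [c [d [O'_s O'_s' [B_basis B_s B_s' [Pc Qd] rev] ->]]]]].
have [cs [ds [rev' cE dE]]] := reversal_exists Pc Qd rev.
exists O', B, cs, ds; split; last first.
  have [_ _ _ c_supp d_supp] := reversalP rev'.
  by rewrite /phi_set cE dE c_supp d_supp.
split=> //.
- exact/circuit_compatibleP.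
- exact/cocircuit_compatibleP.
- exact/is_basisP.
- exact/bbygP.
Qed.

End Represented.

(** * Bijectivity of [phi] and of its restrictions *)

Theorem theorem5p2 (R : realType) (r n : nat) (A : 'M[R]_(r, n))
    (M : matroid 'I_n)
    (A_unimodular : totally_unimodular A) (A_rank : \rank A = r)
    (A_represents : represents A M)
    (sigma sigma' : {set 'I_n} -> 'cV[R]_n)
    (sigma_signature : circuit_signature A M sigma)
    (sigma_acyclic : acyclic (is_circuit M) sigma)
    (sigma'_signature : cocircuit_signature A M sigma')
    (sigma'_acyclic : acyclic (is_cocircuit M) sigma') :
  [/\ (* phi is well defined *)
      forall O S, phi_graph A M sigma sigma' O S <->
        phi A M sigma sigma' O = S,
      (* (1) *)
      bijective (phi A M sigma sigma'),
      (* (2) *)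
      set_bij [set O | circuit_compatible A M sigma O]%classic
              [set I | indep M I]%classic
              (phi A M sigma sigma') /\
      (forall O Ocp B cs ds, circuit_compatible A M sigma O ->
         decomposition A M sigma sigma' O Ocp B cs ds ->
         phi A M sigma sigma' O = B :\: supp_union ds) &
      (* (3) *)
      set_bij [set O | cocircuit_compatible A M sigma' O]%classic
              [set S | spanning M S]%classic
              (phi A M sigma sigma') /\
      (forall O Ocp B cs ds, cocircuit_compatible A M sigma' O ->
         decomposition A M sigma sigma' O Ocp B cs ds ->
         phi A M sigma sigma' O = B :|: supp_union cs)].
Proof.
have P_proj := ker_proj_proj A_rank.
have Q_proj := proj_compl P_proj.
have circE := is_circuitE A_rank A_represents.
have cocircE := is_cocircuitE A_rank A_represents.
have s_sig : signature (ker_proj A) sigma.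
  move=> C; rewrite -circE => /sigma_signature.
  by move/(signed_circuitP A_rank A_represents).
have s'_sig : signature (1%:M - ker_proj A) sigma'.
  move=> C; rewrite -cocircE => /sigma'_signature.
  by move/(signed_cocircuitP A_rank A_represents).
rewrite circE in sigma_acyclic; rewrite cocircE in sigma'_acyclic.
have [p p_pos] := acyclic_positive P_proj s_sig sigma_acyclic.
have [q q_pos] := acyclic_positive Q_proj s'_sig sigma'_acyclic.
have graphP O S := phi_graphP A_rank A_represents s_sig s'_sig O S.
have compatP O := circuit_compatibleP A_rank A_represents sigma O.
have cocompatP O := cocircuit_compatibleP A_rank A_represents sigma' O.
have total O : exists S, phi_graph A M sigma sigma' O S.
  have [O' [c [d [O'_s O'_s' Pc Qd rev]]]] :=
    compat_exists P_proj s_sig s'_sig p_pos q_pos O.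
  have [B [B_basis B_s B_s']] :=
    basis_exists P_proj s_sig s'_sig p_pos q_pos O'_s O'_s'.
  by exists (phi_set B c d); apply/graphP; exists O', B, c, d; split.
have functional O S1 S2 : phi_graph A M sigma sigma' O S1 ->
    phi_graph A M sigma sigma' O S2 -> S1 = S2.
  move=> /graphP[O1 [B1 [c1 [d1 [O1_s O1_s' [B1b B1_s B1_s' [Pc1 Qd1] rev1] ->]]]]].
  move=> /graphP[O2 [B2 [c2 [d2 [O2_s O2_s' [B2b B2_s B2_s' [Pc2 Qd2] rev2] ->]]]]].
  have [O12 -> ->] := compat_unique P_proj s_sig s'_sig p_pos q_pos
    O1_s O1_s' O2_s O2_s' Pc1 Qd1 Pc2 Qd2 rev1 rev2.
  rewrite -O12 in B2_s B2_s'.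
  by rewrite (basis_unique P_proj s_sig s'_sig p_pos q_pos
    B1b B2b B1_s B1_s' B2_s B2_s').
have phiP O : phi_graph A M sigma sigma' O (phi A M sigma sigma' O).
  exact: xgetPex (total O).
have phi_eq O S : phi_graph A M sigma sigma' O S -> phi A M sigma sigma' O = S.
  exact: functional (phiP O).
have phi_inj : injective (phi A M sigma sigma').
  move=> O1 O2 O12; have /graphP[O1' [B1 [c1 [d1 [_ _ dec1 S1]]]]] := phiP O1.
  have /graphP[O2' [B2 [c2 [d2 [_ _ dec2 S2]]]]] := phiP O2.
  apply: (ldecomp_inj P_proj s_sig s'_sig p_pos q_pos dec1 dec2).
  by rewrite -S1 -S2.
have phi_bij : bijective (phi A M sigma sigma').
  by apply: inj_card_bij phi_inj _; rewrite card_ffun card_bool -cardsT -powersetT card_powerset cardsT.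
have indepP (I : {set 'I_n}) : reflect
    (forall v, ker_proj A *m v = v -> supp v \subset I -> v = 0) (indep M I).
  rewrite (indepE A_rank A_represents); apply: (iffP negP) => [I_indep v Pv vI|I_free].
    by apply/eqP/negPn/negP => v_n0; apply: I_indep; apply/ldepP; exists v.
  by move=> /ldepP[v [Pv /eqP v_n0 vI]]; apply/v_n0/I_free.
have indep_compat O : circuit_compatible A M sigma O <->
    indep M (phi A M sigma sigma' O).
  have /graphP[O' [B [c [d [O'_s _ [B_basis _ _ [Pc Qd] rev] ->]]]]] := phiP O.
  have [B_indep _] := B_basis; split=> [/compatP O_s|/indepP S_indep].
    have c0 := compat_reversed0 s_sig p_pos O'_s O_s Pc rev.
    apply/indepP => v Pv vS; apply: B_indep => //; apply: subset_trans vS _.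
    have /eqP supp0 : supp c == set0 by rewrite supp_eq0 c0.
    by rewrite /phi_set supp0 setU0 subsetDl.
  (* The supports of [c] and [d] are disjoint, so [c] is a kernel vector supported in the image,
     which is independent. *)
  apply/compatP; have c0 : c = 0.
    apply: S_indep => //; apply/subsetP => e ec; rewrite in_setD in_setU ec orbT andbT.
    move: ec; rewrite !in_supp; have [t [-> -> _]] := rev e.
    by case: t => [[]|]; rewrite /cpart /dpart ?eqxx.
  by rewrite c0 in rev; apply: reversed0_compat P_proj O'_s Qd rev.
have spanning_compat O : cocircuit_compatible A M sigma' O <->
    spanning M (phi A M sigma sigma' O).
  have /graphP[O' [B [c [d [_ O'_s' [B_basis _ _ [Pc Qd] rev] ->]]]]] := phiP O.
  have rev' := reversedC rev.
  split=> [/cocompatP O_s'|/existsP[B' /andP[/(is_basisP A_rank A_represents)[_ B'_span] B'S]]].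
    have d0 := compat_reversed0 s'_sig q_pos O'_s' O_s' Qd rev'.
    apply/existsP; exists B; apply/andP; split; first by apply/(is_basisP A_rank A_represents).
    have /eqP supp0 : supp d == set0 by rewrite supp_eq0 d0.
    by rewrite /phi_set supp0 setD0 subsetUl.
  (* The row space vector [d] is supported off the image, hence off the basis [B'] contained in
     it. *)
  apply/cocompatP; have d0 : d = 0.
    apply: B'_span => //; apply/subsetP => e ed; rewrite in_setC.
    by apply: contraL ed => /(subsetP B'S); rewrite in_setD => /andP[].
  rewrite d0 in rev'; apply: reversed0_compat Q_proj O'_s' _ rev'.
  by rewrite compl_complK.
have [psi phiK psiK] := phi_bij.
have set_bij_phi (C : orientation n -> Prop) (D : {set 'I_n} -> Prop) :
    (forall O, C O <-> D (phi A M sigma sigma' O)) ->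
    set_bij [set O | C O]%classic [set S | D S]%classic (phi A M sigma sigma').
  move=> CD; split=> [O /CD//|O1 O2 _ _ /phi_inj//|S DS].
  by exists (psi S) => //=; apply/CD; rewrite psiK.
split=> //.
- by move=> O S; split=> [/phi_eq|<-].
- split=> [|O Ocp B cs ds O_s dec]; first exact: set_bij_phi.
  rewrite (phi_eq O ((B :|: supp_union cs) :\: supp_union ds)); last first.
    by exists Ocp, B, cs, ds.
  have [Ocp_s _ rev _ _] := dec.
  have [Pc _ rev' <- _] := reversalP A_rank A_represents rev.
  have c0 := compat_reversed0 s_sig p_pos ((compatP _).1 Ocp_s) ((compatP _).1 O_s) Pc rev'.
  have /eqP -> : supp (\sum_(v <- cs) v) == set0 by rewrite supp_eq0 c0.
  by rewrite setU0.
- split=> [|O Ocp B cs ds O_s dec]; first exact: set_bij_phi.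
  rewrite (phi_eq O ((B :|: supp_union cs) :\: supp_union ds)); last first.
    by exists Ocp, B, cs, ds.
  have [_ Ocp_s rev _ _] := dec.
  have [_ Qd rev' _ <-] := reversalP A_rank A_represents rev.
  have d0 := compat_reversed0 s'_sig q_pos ((cocompatP _).1 Ocp_s)
    ((cocompatP _).1 O_s) Qd (reversedC rev').
  have /eqP -> : supp (\sum_(v <- ds) v) == set0 by rewrite supp_eq0 d0.
  by rewrite setD0.
Qed.
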